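(* Let $i_1,i_2,i_3$ be non-negative integers and let $\mu,\alpha,\beta\in K$ satisfy $\nu(\wp(\mu))\ge i_2-pi_1$, $\nu(\wp(\alpha)+\wp(\mu)\beta)\ge i_3-pi_1$, $\nu(\wp(\beta))\ge i_3-pi_2$, $\nu(\mu)\ge i_3-i_1$ and $i_2\ge i_3$. Let $$H^*_{i_1,i_2,i_3,\mu,\alpha,\beta} = R[\pi^{i_1}(\xi_{1,0,0}-\mu\xi_{0,1,0}-\alpha\xi_{0,0,1}),\ \pi^{i_2}(\xi_{0,1,0}-\beta\xi_{0,0,1}),\ \pi^{i_3}\xi_{0,0,1}]\subseteq (K[C_p^3])^*$$ and $$E(i_1,i_2,i_3,\mu,\alpha,\beta)=R\left [\frac{g_1-1}{\pi^{i_1}},\ \frac{g_2g_1^{[\mu]}-1}{\pi^{i_2}},\ \frac{g_3g_1^{[\alpha]}(g_2g_1^{[\mu]})^{[\beta]}-1}{\pi^{i_3}}\right ]\subseteq K[C_p^3].$$ Then $$(H^*_{i_1,i_2,i_3,\mu,\alpha,\beta})^*=E(i_1,i_2,i_3,\mu,\alpha,\beta).$$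
   Context: Let $p$ be a prime and let $K$ be a field of characteristic $p$ that is complete with respect to a discrete valuation $\nu:K\to\mathbb{Z}\cup\{\infty\}$ with uniformizing parameter $\pi$, $\nu(\pi)=1$. Let $R=\{x\in K\mid \nu(x)\ge 0\}$. For $x\in K$ put $\wp(x)=x^p-x$. The truncated exponential is $x^{[y]}=\sum_{m=0}^{p-1}\binom{y}{m}(x-1)^m$, where $\binom{y}{m}=y(y-1)\cdots(y-m+1)/m!$. $C_p^3=\langle g_1,g_2,g_3\rangle$ is the elementary abelian group of order $p^3$, $(K[C_p^3])^*$ is the linear dual Hopf algebra of the group ring $K[C_p^3]$, and $\langle -,-\rangle:(K[C_p^3])^*\times K[C_p^3]\to K$ is the duality pairing. The elements $\xi_{1,0,0},\xi_{0,1,0},\xi_{0,0,1}\in (K[C_p^3])^*$ are defined by $\langle \xi_{1,0,0},(g_1-1)^j(g_2-1)^k(g_3-1)^l\rangle=\delta_{1,j}\delta_{0,k}\delta_{0,l}$, $\langle \xi_{0,1,0},(g_1-1)^j(g_2-1)^k(g_3-1)^l\rangle=\delta_{0,j}\delta_{1,k}\delta_{0,l}$, $\langle \xi_{0,0,1},(g_1-1)^j(g_2-1)^k(g_3-1)^l\rangle=\delta_{0,j}\delta_{0,k}\delta_{1,l}$ for $0\le j,k,l\le p-1$. $R[\ldots]$ denotes the $R$-subalgebra generated by the indicated elements. For an $R$-Hopf order $H$ in $(K[C_p^3])^*$, its linear dual $H^*$ is regarded as an $R$-Hopf order in $K[C_p^3]$ through the pairing, i.e. $H^*=\{x\in K[C_p^3]\mid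 \langle h,x\rangle\in R\ \text{for all } h\in H\}$. *)

(* Defs.v *)
From HB Require Import structures.
From mathcomp Require Import all_boot all_order all_algebra.
From mathcomp Require Import all_fingroup all_solvable.
From mathcomp Require Import boolp classical_sets constructive_ereal.

Set Implicit Arguments.
Unset Strict Implicit.
Unset Printing Implicit Defensive.

Import GRing.Theory.

Local Open Scope classical_set_scope.
Local Open Scope ring_scope.

(* \bar int also contains -oo, which [dval_fin] excludes from the values of v. *)
Record discrete_valuation (K : fieldType) (v : K -> \bar int) : Prop := {
  dval0 : v 0 = +oo%E;
  dval_fin : forall x, x != 0 -> v x \is a fin_num;
  dvalM : forall x y, v (x * y)%R = (v x + v y)%E;
  dvalD : forall x y, (Order.min (v x) (v y) <= v (x + y)%R)%E
}.

Definition valuation_complete (K : fieldType) (v : K -> \bar int) : Prop :=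
  forall u : nat -> K,
    (forall N : int, exists n0 : nat, forall m n : nat,
       (n0 <= m)%N -> (n0 <= n)%N -> (N%:E <= v (u m - u n)%R)%E) ->
    exists l : K, forall N : int, exists n0 : nat, forall n : nat,
      (n0 <= n)%N -> (N%:E <= v (u n - l)%R)%E.

Definition valuation_ring (K : fieldType) (v : K -> \bar int) : set K :=
  [set x | (0%:E <= v x)%E].

Record is_subalgebra (K : fieldType) (R : set K) (A : algType K) (B : set A) :
    Prop := {
  subalg1 : B 1;
  subalgB : forall x y, B x -> B y -> B (x - y);
  subalgM : forall x y, B x -> B y -> B (x * y);
  subalgZ : forall c x, R c -> B x -> B (c *: x)
}.

Definition subalgebra_gen (K : fieldType) (R : set K) (A : algType K)
    (S : set A) : set A := smallest (@is_subalgebra K R A) S.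

Definition wp (K : fieldType) (p : nat) (x : K) : K := x ^+ p - x.

Definition gbinom (K : fieldType) (y : K) (m : nat) : K :=
  (\prod_(i < m) (y - i%:R)) / m`!%:R.

Definition trunc_exp (K : fieldType) (A : algType K) (p : nat) (x : A) (y : K) :
    A := \sum_(m < p) gbinom y m *: (x - 1) ^+ m.

(* The group algebra K[G], G being the whole of gT: x stands for
   \sum_g x g *: g, and the product is convolution. *)
Definition galg (K : fieldType) (gT : finGroupType) : Type := {ffun gT -> K}.

HB.instance Definition _ (K : fieldType) (gT : finGroupType) :=
  GRing.Lmodule.copy (galg K gT) {ffun gT -> K^o}.
HB.instance Definition _ (K : fieldType) (gT : finGroupType) :=
  Vector.copy (galg K gT) {ffun gT -> K^o}.

Section GroupAlgebra.
Variables (K : fieldType) (gT : finGroupType).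
Implicit Types x y z : galg K gT.

Definition gelt (g : gT) : galg K gT := [ffun h => (h == g)%:R].

Definition galg_mul x y : galg K gT :=
  [ffun g => \sum_(h : gT) x h * y (h^-1 * g)%g].

Fact galg_mulA : associative galg_mul.
Proof.
move=> x y z; apply/ffunP=> g; rewrite !ffunE.
under eq_bigr do rewrite ffunE big_distrr /=.
under [RHS]eq_bigr do rewrite ffunE big_distrl /=.
rewrite [RHS]exchange_big /=; apply: eq_bigr => h _.
rewrite (reindex_inj (mulgI h^-1%g)) /=; apply: eq_bigr => k _.
by rewrite mulrA; congr (_ * _ * z _); rewrite invMg invgK -!mulgA mulKVg.
Qed.

Fact galg_mul1l : left_id (gelt 1%g) galg_mul.
Proof.
move=> x; apply/ffunP=> g; rewrite ffunE (bigD1 1%g) //= ffunE eqxx mul1r.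
by rewrite invg1 mul1g big1 ?addr0 // => h /negPf h1; rewrite ffunE h1 mul0r.
Qed.

Fact galg_mul1r : right_id (gelt 1%g) galg_mul.
Proof.
move=> x; apply/ffunP=> g; rewrite ffunE (bigD1 g) //= ffunE mulVg eqxx mulr1.
rewrite big1 ?addr0 // => h /negPf hg.
by rewrite ffunE -(inj_eq (mulgI h)) mulKVg mulg1 eq_sym hg mulr0.
Qed.

Fact galg_mulDl : left_distributive galg_mul +%R.
Proof.
move=> x y z; apply/ffunP=> g; rewrite !ffunE -big_split /=.
by apply: eq_bigr => h _; rewrite ffunE mulrDl.
Qed.

Fact galg_mulDr : right_distributive galg_mul +%R.
Proof.
move=> x y z; apply/ffunP=> g; rewrite !ffunE -big_split /=.
by apply: eq_bigr => h _; rewrite ffunE mulrDr.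
Qed.

Fact galg_one_neq0 : gelt 1%g != 0.
Proof.
by apply/eqP => /ffunP/(_ 1%g)/eqP; rewrite !ffunE eqxx oner_eq0.
Qed.

HB.instance Definition _ := GRing.Zmodule_isNzRing.Build (galg K gT)
  galg_mulA galg_mul1l galg_mul1r galg_mulDl galg_mulDr galg_one_neq0.

Fact galg_scaleAl (a : K) x y : a *: (x * y) = a *: x * y.
Proof.
apply/ffunP=> g; rewrite !ffunE scaler_sumr.
by apply: eq_bigr => h _; rewrite ffunE; apply: mulrA.
Qed.

HB.instance Definition _ := GRing.Lmodule_isLalgebra.Build K (galg K gT)
  galg_scaleAl.

Fact galg_scaleAr (a : K) x y : a *: (x * y) = x * (a *: y).
Proof.
apply/ffunP=> g; rewrite !ffunE scaler_sumr.
by apply: eq_bigr => h _; rewrite ffunE; apply: mulrCA.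
Qed.

HB.instance Definition _ := GRing.Lalgebra_isAlgebra.Build K (galg K gT)
  galg_scaleAr.

End GroupAlgebra.

(* The linear dual of K[G].  Its algebra structure is the transpose of the
   coalgebra structure of K[G], in which every g in G is group-like:
   <f1 * f2, g> = <f1, g> <f2, g> and <1, g> = 1 for all g in G. *)
Definition gdual (K : fieldType) (gT : finGroupType) : Type :=
  'Hom(galg K gT, K^o).

HB.instance Definition _ (K : fieldType) (gT : finGroupType) :=
  Vector.copy (gdual K gT) 'Hom(galg K gT, K^o).

Definition pairing (K : fieldType) (gT : finGroupType) (f : gdual K gT)
    (x : galg K gT) : K := (f : 'Hom(galg K gT, K^o)) x.

Section Dual.
Variables (K : fieldType) (gT : finGroupType).
Implicit Types f : gdual K gT.

Definition lin_ext (c : gT -> K) (x : galg K gT) : K^o := \sum_(g : gT) x g * c g.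

Fact lin_ext_is_linear c : linear (lin_ext c).
Proof.
move=> a x y; rewrite /lin_ext scaler_sumr -big_split /=.
by apply: eq_bigr => g _; rewrite !ffunE mulrDl; congr (_ + _); apply/esym/mulrA.
Qed.

HB.instance Definition _ c := GRing.isLinear.Build K (galg K gT) K^o *:%R
  (lin_ext c) (lin_ext_is_linear c).

Definition gdual_mul f1 f2 : gdual K gT :=
  linfun (lin_ext (fun g => pairing f1 (gelt K g) * pairing f2 (gelt K g))).

Definition gdual_one : gdual K gT := linfun (lin_ext (fun=> 1)).

Fact lin_ext_gelt c g : lin_ext c (gelt K g) = c g.
Proof.
rewrite /lin_ext (bigD1 g) //= ffunE eqxx mul1r big1 ?addr0 // => h /negPf hg.
by rewrite ffunE hg mul0r.
Qed.

Fact galg_basis (x : galg K gT) : x = \sum_(g : gT) x g *: gelt K g.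
Proof.
apply/ffunP=> h; rewrite sum_ffunE (bigD1 h) //= !ffunE eqxx.
rewrite big1 ?addr0; first by rewrite [_ *: _]mulr1.
by move=> g /negPf hg; rewrite !ffunE eq_sym hg [_ *: _]mulr0.
Qed.

Fact gdual_ext f1 f2 :
  (forall g, pairing f1 (gelt K g) = pairing f2 (gelt K g)) -> f1 = f2.
Proof.
move=> eqf; apply/lfunP => x; rewrite (galg_basis x) !linear_sum /=.
by apply: eq_bigr => g _; rewrite !linearZ /=; congr (_ *: _); apply: eqf.
Qed.

Fact pairing_mul f1 f2 g : pairing (gdual_mul f1 f2) (gelt K g) =
  pairing f1 (gelt K g) * pairing f2 (gelt K g).
Proof. by rewrite {1}/pairing lfunE /= lin_ext_gelt. Qed.

Fact pairing_one g : pairing gdual_one (gelt K g) = 1.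
Proof. by rewrite /pairing lfunE /= lin_ext_gelt. Qed.

Fact pairingDl f1 f2 x : pairing (f1 + f2) x = pairing f1 x + pairing f2 x.
Proof. by rewrite /pairing lfunE. Qed.

Fact pairingZl a f x : pairing (a *: f) x = a * pairing f x.
Proof. by rewrite /pairing lfunE. Qed.

Fact gdual_mulA : associative gdual_mul.
Proof. by move=> f1 f2 f3; apply: gdual_ext => g; rewrite !pairing_mul mulrA. Qed.

Fact gdual_mul1l : left_id gdual_one gdual_mul.
Proof.
by move=> f; apply: gdual_ext => g; rewrite pairing_mul pairing_one mul1r.
Qed.

Fact gdual_mul1r : right_id gdual_one gdual_mul.
Proof.
by move=> f; apply: gdual_ext => g; rewrite pairing_mul pairing_one mulr1.
Qed.

Fact gdual_mulDl : left_distributive gdual_mul +%R.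
Proof.
move=> f1 f2 f3; apply: gdual_ext => g.
by rewrite !(pairing_mul, pairingDl) mulrDl.
Qed.

Fact gdual_mulDr : right_distributive gdual_mul +%R.
Proof.
move=> f1 f2 f3; apply: gdual_ext => g.
by rewrite !(pairing_mul, pairingDl) mulrDr.
Qed.

Fact gdual_one_neq0 : gdual_one != 0.
Proof.
apply/eqP => /(congr1 (fun f => pairing f (gelt K 1%g)))/eqP.
by rewrite pairing_one /pairing lfunE /= oner_eq0.
Qed.

HB.instance Definition _ := GRing.Zmodule_isNzRing.Build (gdual K gT)
  gdual_mulA gdual_mul1l gdual_mul1r gdual_mulDl gdual_mulDr gdual_one_neq0.

Fact gdual_scaleAl (a : K) f1 f2 : a *: (f1 * f2) = a *: f1 * f2.
Proof.
by apply: gdual_ext => g; rewrite pairingZl !pairing_mul pairingZl mulrA.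
Qed.

HB.instance Definition _ := GRing.Lmodule_isLalgebra.Build K (gdual K gT)
  gdual_scaleAl.

Fact gdual_scaleAr (a : K) f1 f2 : a *: (f1 * f2) = f1 * (a *: f2).
Proof.
by apply: gdual_ext => g; rewrite pairingZl !pairing_mul pairingZl mulrCA.
Qed.

HB.instance Definition _ := GRing.Lalgebra_isAlgebra.Build K (gdual K gT)
  gdual_scaleAr.

End Dual.

Definition dual_order (K : fieldType) (R : set K) (gT : finGroupType)
    (H : set (gdual K gT)) : set (galg K gT) :=
  [set x | forall h, H h -> R (pairing h x)].

(* xi is the element of the basis dual to the basis (g1-1)^j (g2-1)^k (g3-1)^l
   of K[G] indexed by (a, b, c). *)
Definition is_xi (K : fieldType) (p : nat) (gT : finGroupType) (g1 g2 g3 : gT)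
    (a b c : nat) (xi : gdual K gT) : Prop :=
  forall j k l : nat, (j < p)%N -> (k < p)%N -> (l < p)%N ->
    pairing xi ((gelt K g1 - 1) ^+ j * (gelt K g2 - 1) ^+ k *
                (gelt K g3 - 1) ^+ l)
    = (a == j)%:R * (b == k)%:R * (c == l)%:R.

Definition Hstar (K : fieldType) (v : K -> \bar int) (pi : K)
    (gT : finGroupType) (xi100 xi010 xi001 : gdual K gT)
    (i1 i2 i3 : nat) (mu alpha beta : K) : set (gdual K gT) :=
  subalgebra_gen (valuation_ring v)
    [set pi ^+ i1 *: (xi100 - mu *: xi010 - alpha *: xi001);
         pi ^+ i2 *: (xi010 - beta *: xi001);
         pi ^+ i3 *: xi001].

Definition Eorder (K : fieldType) (p : nat) (v : K -> \bar int) (pi : K)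
    (gT : finGroupType) (g1 g2 g3 : gT)
    (i1 i2 i3 : nat) (mu alpha beta : K) : set (galg K gT) :=
  let x1 := gelt K g1 in
  let x2 := gelt K g2 * trunc_exp p x1 mu in
  let x3 := gelt K g3 * trunc_exp p x1 alpha * trunc_exp p x2 beta in
  subalgebra_gen (valuation_ring v)
    [set pi ^- i1 *: (x1 - 1);
         pi ^- i2 *: (x2 - 1);
         pi ^- i3 *: (x3 - 1)].

(* Main.v *)
Require Import Defs.
From mathcomp Require Import all_boot all_order all_algebra.
From mathcomp Require Import all_fingroup all_solvable.
From mathcomp Require Import boolp classical_sets constructive_ereal.
From HB Require Import structures.
From mathcomp Require Import ring zify.

(** Every f in the dual acts on K[G] by f . g = f(g) g for g in G; this is an
    action of the dual algebra, and <f, x> = eps (f . x) with eps the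
    augmentation of K[G].  The three functionals xi are additive functions on
    G, so they act as derivations, and so do the three generators A, B, C of
    the order H* ([gdual_act_derivation], [xi_additive]).

    The truncated exponential has an explicit logarithmic derivative: if
    D x = u x and (x - 1)^p = 0, then
      D (x^[b]) = u (b + wp(b) (x - 1)^(p-1)) x^[b]     ([dlog_trunc_exp]),
    where the last term records the failure of the truncation to be a true
    exponential.  This gives the logarithmic derivatives of the three twisted
    group elements x1 = g1, x2 = g2 g1^[mu] and
    x3 = g3 g1^[alpha] x2^[beta]; written in terms of the generators
    y_m = (x_m - 1)/pi^(i_m) of E, they have exactly the coefficients which the
    hypotheses on wp(mu), wp(alpha) + wp(mu) beta and wp(beta) make integral.
    Hence A, B, C preserve E ([der_twisted_order]).  Then so does all of H*, and
    <h, e> = eps (h . e) is integral because eps is integral on E: E is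
    contained in the dual of H*.

    For the converse, filter K[G] by the span of the monomials of degree >= n
    in y1, y2, y3.  This is the filtration by powers of the augmentation ideal;
    it begins with K[G], since the truncated exponentials are invertible, and
    it reaches 0, since y_m^p = 0.  The derivations A, B, C lower the degree by
    one and act on the associated graded algebra as the partial derivatives
    d/dy1, d/dy2, d/dy3 ([aug_der_twisted]).  So a monomial A^i B^j C^k pairs
    with filtration degree > i + j + k to 0, and with the monomials of degree
    i + j + k to i! j! k! on y1^i y2^j y3^k and to 0 on the others
    ([aug_dop_mon]).  For i, j, k < p this factor is a unit of the prime
    field, so an element of the dual of H* has integral leading coefficients;
    subtracting the leading part, which lies in E, raises its filtration degree,
    and finitely many steps exhaust it ([mem_subalgebra_gen_dop]). *)

Set Implicit Arguments.
Unset Strict Implicit.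
Unset Printing Implicit Defensive.

Import Order.TTheory GRing.Theory Num.Theory.
Local Open Scope classical_set_scope.
Local Open Scope ring_scope.

(** * Binomial coefficients in characteristic p *)

Section PrimeCharacteristic.
Variables (K : fieldType) (p : nat).
Hypothesis charK : p \in [pchar K].

Let p_prime : prime p := pcharf_prime charK.

Lemma natr_pchar_neq0 n : (0 < n < p)%N -> n%:R != 0 :> K.
Proof.
case/andP=> n0 np; rewrite -(dvdn_pcharf charK).
by apply/negP => /(dvdn_leq n0); rewrite leqNgt np.
Qed.

Lemma fact_pchar_neq0 n : (n < p)%N -> n`!%:R != 0 :> K.
Proof.
elim: n => [|n IHn] np; first by rewrite fact0 oner_eq0.
rewrite factS natrM; apply: mulf_neq0; first exact: natr_pchar_neq0.
exact: IHn (ltnW np).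
Qed.

Lemma natr_inv_pchar n : n%:R != 0 :> K -> exists m, m%:R * n%:R = 1 :> K.
Proof.
move=> n_neq0.
have n0 : (0 < n)%N by case: n n_neq0 => //; rewrite eqxx.
case: (egcdnP p n0) => km kn eq_g _; exists km.
rewrite -natrM eq_g natrD natrM (pcharf0 charK) mulr0 add0r.
suff -> : gcdn n p = 1%N by [].
apply/eqP; rewrite -/(coprime n p) coprime_sym prime_coprime //.
by rewrite (dvdn_pcharf charK).
Qed.

(** X^p - X is monic of degree p and vanishes on the p elements of the prime
    field. *)
Lemma prod_natr_pchar (y : K) : \prod_(i < p) (y - i%:R) = wp p y.
Proof.
pose P : {poly K} := 'X^p - 'X.
have szP : size P = p.+1.
  by rewrite /P size_polyDl size_polyXn // size_polyN size_polyX ltnS prime_gt1.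
pose rs := [seq i%:R : K | i <- iota 0 p].
have -> : wp p y = P.[y] by rewrite /P !hornerE.
have rP : all (root P) rs.
  apply/allP => _ /mapP[i _ ->].
  rewrite rootE /P !hornerE -[_ ^+ p](pFrobenius_autE charK).
  by rewrite pFrobenius_aut_nat subrr.
have urs : uniq_roots rs.
  rewrite uniq_rootsE map_inj_in_uniq ?iota_uniq //.
  have wlogH : forall i j, (i <= j < p)%N -> i%:R = j%:R :> K -> i = j.
    move=> i j /andP[ij jp] eq_ij; apply/eqP; rewrite eqn_leq ij leqNgt.
    apply/negP => ltij; have /eqP[] : (j - i)%:R != 0 :> K.
      by rewrite natr_pchar_neq0 // subn_gt0 ltij (leq_ltn_trans _ jp) ?leq_subr.
    by rewrite natrB // eq_ij subrr.
  move=> i j; rewrite !mem_iota !add0n => ip jp eq_ij.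
  have [ij|/ltnW ij] := leqP i j; first by apply: wlogH; rewrite ?ij.
  by apply/esym/wlogH; rewrite ?ij.
have szrs : size rs = p by rewrite size_map size_iota.
have -> : P = lead_coef P *: \prod_(z <- rs) ('X - z%:P).
  by apply: all_roots_prod_XsubC => //; rewrite szP szrs.
have -> : lead_coef P = 1.
  rewrite /P lead_coefDl ?lead_coefXn // size_polyXn size_polyN size_polyX.
  by rewrite ltnS prime_gt1.
rewrite scale1r horner_prod big_map -[X in iota 0 X]subn0 big_mkord.
by apply: eq_bigr => i _; rewrite !hornerE.
Qed.

Lemma fact_pred_pchar : (p.-1)`!%:R = -1 :> K.
Proof.
apply/eqP; rewrite -subr_eq0 opprK natr1 -(dvdn_pcharf charK).
by rewrite -Wilson // prime_gt1.
Qed.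

Lemma gbinom0 (y : K) : gbinom y 0 = 1.
Proof. by rewrite /gbinom big_ord0 fact0 divr1. Qed.

Lemma gbinomS (y : K) m : (m.+1 < p)%N ->
  m.+1%:R * gbinom y m.+1 = (y - m%:R) * gbinom y m.
Proof.
move=> mp; rewrite /gbinom big_ord_recr /= factS natrM.
have := fact_pchar_neq0 (ltnW mp); have := @natr_pchar_neq0 m.+1 mp.
by move=> h1 h2; field; rewrite -natr1 addrC in h1; apply/andP; split.
Qed.

(** At the last index the recursion [gbinomS] breaks down, because
    p! = 0; its right side is then not 0 but wp, up to sign, since
    (p-1)! = -1. *)
Lemma gbinom_pred_pchar (y : K) :
  (p.-1%:R - y) * gbinom y p.-1 = wp p y.
Proof.
rewrite -prod_natr_pchar.
have -> : \prod_(i < p) (y - i%:R) = \prod_(i < p.-1.+1) (y - i%:R).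
  by rewrite (prednK (prime_gt0 p_prime)).
rewrite big_ord_recr /= /gbinom fact_pred_pchar.
by rewrite invrN invr1; ring.
Qed.

End PrimeCharacteristic.

(** * Derivations of a commutative algebra *)

Section Derivations.
Variables (K : fieldType) (A : comAlgType K).

Record is_derivation (D : A -> A) : Prop := {
  derD : {morph D : x y / x + y};
  derZ : forall c, {morph D : x / c *: x};
  derM : forall x y, D (x * y) = D x * y + x * D y }.

Variable D : A -> A.
Hypothesis derD_ : is_derivation D.
Let derD := derD derD_.
Let derZ := derZ derD_.
Let derM := derM derD_.

Lemma der0 : D 0 = 0.
Proof. by have := derZ 0 0; rewrite !scale0r. Qed.

Lemma der1 : D 1 = 0.
Proof.
by have /eqP := derM 1 1; rewrite !mul1r !mulr1 -subr_eq subrr eq_sym => /eqP.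
Qed.

Lemma derB x y : D (x - y) = D x - D y.
Proof. by rewrite derD -!scaleN1r derZ. Qed.

Lemma der_sum I (r : seq I) (P : pred I) (F : I -> A) :
  D (\sum_(i <- r | P i) F i) = \sum_(i <- r | P i) D (F i).
Proof. exact: (big_morph D derD der0). Qed.

Lemma der_exp x n : D (x ^+ n) = x ^+ n.-1 *+ n * D x.
Proof.
elim: n => [|[|n] IHn]; first by rewrite expr0 der1 mulr0n mul0r.
  by rewrite expr1 expr0 mul1r.
by rewrite exprS derM IHn /= !exprS; ring.
Qed.

End Derivations.

(** * The truncated exponential *)

Section TruncatedExponential.
Variables (K : fieldType) (p : nat) (A : comAlgType K).
Hypothesis charK : p \in [pchar K].

Let p_gt0 : (0 < p)%N := prime_gt0 (pcharf_prime charK).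

Lemma trunc_expE (x : A) b :
  trunc_exp p x b = \sum_(m < p.-1.+1) gbinom b m *: (x - 1) ^+ m.
Proof. by rewrite (prednK p_gt0). Qed.

Lemma trunc_exp_split (x : A) b :
  exists s, trunc_exp p x b = 1 + (x - 1) * s.
Proof.
exists (\sum_(m < p.-1) gbinom b m.+1 *: (x - 1) ^+ m).
rewrite trunc_expE big_ord_recl /= gbinom0 scale1r expr0.
rewrite mulr_sumr; congr (_ + _); apply: eq_bigr => m _.
by rewrite exprS scalerAr.
Qed.

(** The power (x - 1)^(p-1) is killed by x - 1, hence fixed by every element
    of 1 + (x - 1)A. *)
Lemma trunc_exp_mul_socle (x : A) b :
  (x - 1) ^+ p = 0 -> trunc_exp p x b * (x - 1) ^+ p.-1 = (x - 1) ^+ p.-1.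
Proof.
have [s ->] := trunc_exp_split x b => x_unip.
rewrite mulrDl mul1r mulrAC -exprS (prednK p_gt0).
by rewrite x_unip mul0r addr0.
Qed.

Lemma unipotent_exp (x : A) : (x - 1) ^+ p = 0 -> x ^+ p = 1.
Proof.
have charA := rmorph_pchar (in_alg A) charK.
rewrite -(pFrobenius_autE charA) pFrobenius_autB_comm; last exact: mulrC.
by rewrite pFrobenius_aut1 pFrobenius_autE => /eqP; rewrite subr_eq0 => /eqP.
Qed.

Lemma exp_unipotent (x : A) : x ^+ p = 1 -> (x - 1) ^+ p = 0.
Proof.
have charA := rmorph_pchar (in_alg A) charK => xp.
rewrite -(pFrobenius_autE charA) pFrobenius_autB_comm; last exact: mulrC.
by rewrite pFrobenius_aut1 pFrobenius_autE xp subrr.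
Qed.

Lemma trunc_exp_order (x : A) b : x ^+ p = 1 -> trunc_exp p x b ^+ p = 1.
Proof.
move/exp_unipotent => x_unip; apply: unipotent_exp.
have [s ->] := trunc_exp_split x b.
by rewrite addrAC subrr add0r exprMn x_unip mul0r.
Qed.

(** The operator (1 + X) d/dX has eigenvalue b on the full binomial series;
    cutting the series at degree n leaves one boundary term. *)
Lemma euler_trunc_sum (X : A) b n : (n < p)%N ->
  \sum_(m < n.+1) gbinom b m *: (X ^+ m.-1 *+ m * (1 + X)) =
  b *: (\sum_(m < n.+1) gbinom b m *: X ^+ m)
  + ((n%:R - b) * gbinom b n) *: X ^+ n.
Proof.
elim: n => [|n IHn] np.
  rewrite !big_ord_recl !big_ord0 !addr0 gbinom0 mulr0n mul0r scaler0 !scale1r.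
  by rewrite sub0r mulr1 expr0 scaleNr subrr.
rewrite big_ord_recr /= IHn ?(ltnW np) // [in RHS]big_ord_recr /= scalerDr.
rewrite -!addrA; congr (_ + _).
have -> : X ^+ n *+ n.+1 * (1 + X) = n.+1%:R *: X ^+ n + n.+1%:R *: X ^+ n.+1.
  by rewrite -scaler_nat -scalerAl mulrDr mulr1 -exprSr scalerDr.
rewrite scalerDr !scalerA addrA -scalerDl.
rewrite [gbinom b n.+1 * _ in X in X *: _]mulrC (gbinomS charK b np) -mulrDl.
have -> : n%:R - b + (b - n%:R) = 0 by ring.
by rewrite mul0r scale0r add0r -scalerDl; congr (_ *: _); ring.
Qed.

(** The boundary term of [euler_trunc_sum] at n = p - 1 is
    wp(b) (x - 1)^(p-1), which may be multiplied by the truncated exponential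
    without changing it: this puts the result in logarithmic form, so that
    it can be iterated. *)
Lemma dlog_trunc_exp (D : A -> A) (x u : A) b :
  is_derivation D -> D x = u * x -> (x - 1) ^+ p = 0 ->
  D (trunc_exp p x b) =
  u * (b%:A + wp p b *: (x - 1) ^+ p.-1) * trunc_exp p x b.
Proof.
move=> derD_ Dx x_unip.
have -> : D (trunc_exp p x b) =
    u * \sum_(m < p.-1.+1)
          gbinom b m *: ((x - 1) ^+ m.-1 *+ m * (1 + (x - 1))).
  rewrite trunc_expE (der_sum derD_) mulr_sumr; apply: eq_bigr => m _.
  rewrite (derZ derD_) (der_exp derD_) (derB derD_) (der1 derD_) subr0 Dx [1 + _]addrC.
  by rewrite subrK -scalerAr mulrCA.
rewrite euler_trunc_sum ?ltn_predL // -trunc_expE gbinom_pred_pchar // -mulrA.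
congr (_ * _); rewrite mulrDl -scalerAl mul1r; congr (_ + _).
by rewrite -scalerAl mulrC trunc_exp_mul_socle.
Qed.

Lemma dlog_mul (D : A -> A) (x y u w : A) :
  is_derivation D -> D x = u * x -> D y = w * y -> D (x * y) = (u + w) * (x * y).
Proof. by move=> derD_ Dx Dy; rewrite (derM derD_) Dx Dy; ring. Qed.

End TruncatedExponential.

(** * The filtration by degree in three elements *)

Section Filtration.
Variables (K : fieldType) (A : comAlgType K) (y1 y2 y3 : A).

Definition monomial i j k : A := y1 ^+ i * y2 ^+ j * y3 ^+ k.
Local Notation mon := monomial.

(** The exponents are not bounded by p, so that products of monomials are
    again monomials; for nilpotent y1, y2, y3 those with an exponent >= p
    vanish. *)
Inductive filtration (n : nat) : A -> Prop :=
  | fil_mon i j k of (n <= i + j + k)%N : filtration n (mon i j k)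
  | fil0 : filtration n 0
  | filD x y of filtration n x & filtration n y : filtration n (x + y)
  | filZ c x of filtration n x : filtration n (c *: x).
Local Notation fil := filtration.

Lemma filB n x y : fil n x -> fil n y -> fil n (x - y).
Proof. by move=> fx fy; rewrite -scaleN1r; apply: filD => //; apply: filZ. Qed.

Lemma fil_sub m n x : (m <= n)%N -> fil n x -> fil m x.
Proof.
move=> mn; elim=> [i j k nijk||x1 x2 _ f1 _ f2|c x1 _ f1].
- by apply: fil_mon; apply: leq_trans nijk.
- exact: fil0.
- exact: filD.
- exact: filZ.
Qed.

Lemma monM i j k i' j' k' :
  mon i j k * mon i' j' k' = mon (i + i') (j + j') (k + k').
Proof. by rewrite /monomial !exprD; ring. Qed.

Lemma filM m n x y : fil m x -> fil n y -> fil (m + n) (x * y).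
Proof.
move=> fx fy; elim: fx => [i j k mijk||x1 x2 _ f1 _ f2|c x1 _ f1].
- elim: fy => [i' j' k' nijk||x1 x2 _ f1 _ f2|c x1 _ f1].
  + by rewrite monM; apply: fil_mon; lia.
  + by rewrite mulr0; apply: fil0.
  + by rewrite mulrDr; apply: filD.
  + by rewrite -scalerAr; apply: filZ.
- by rewrite mul0r; apply: fil0.
- by rewrite mulrDl; apply: filD.
- by rewrite -scalerAl; apply: filZ.
Qed.

Lemma fil1 : fil 0 1.
Proof.
by have := @fil_mon 0 0 0 0 isT; rewrite /monomial !expr0 !mulr1.
Qed.

Lemma fil_gen1 : fil 1 y1.
Proof. by have := @fil_mon 1 1 0 0 isT; rewrite /monomial expr1 !expr0 !mulr1. Qed.

Lemma fil_gen2 : fil 1 y2.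
Proof. by have := @fil_mon 1 0 1 0 isT; rewrite /monomial expr1 !expr0 mulr1 mul1r. Qed.

Lemma fil_gen3 : fil 1 y3.
Proof. by have := @fil_mon 1 0 0 1 isT; rewrite /monomial expr1 !expr0 !mul1r. Qed.

Lemma fil0M x y : fil 0 x -> fil 0 y -> fil 0 (x * y).
Proof. exact: filM. Qed.

Lemma fil0X x n : fil 0 x -> fil 0 (x ^+ n).
Proof.
move=> fx; elim: n => [|n IHn]; first by rewrite expr0; apply: fil1.
by rewrite exprS; apply: fil0M.
Qed.

Lemma fil_sum n I (r : seq I) (P : pred I) (F : I -> A) :
  (forall i, P i -> fil n (F i)) -> fil n (\sum_(i <- r | P i) F i).
Proof.
move=> fF; elim/big_rec: _ => [|i x Pi fx]; first exact: fil0.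
by apply: filD; first exact: fF.
Qed.

Section Nilpotent.
Variable p : nat.
Hypotheses (y1p : y1 ^+ p = 0) (y2p : y2 ^+ p = 0) (y3p : y3 ^+ p = 0).

Lemma mon_eq0 i j k : ~~ [&& i < p, j < p & k < p]%N -> mon i j k = 0.
Proof.
have exp0 y m : y ^+ p = 0 -> (p <= m)%N -> y ^+ m = 0 :> A.
  by move=> yp pm; rewrite -(subnK pm) exprD yp mulr0.
rewrite /monomial !negb_and -!leqNgt => /or3P[] pm.
- by rewrite (exp0 y1) // !mul0r.
- by rewrite (exp0 y2) // mulr0 mul0r.
- by rewrite (exp0 y3) // mulr0.
Qed.

Lemma fil_eq0 n x : (3 * p <= n)%N -> fil n x -> x = 0.
Proof.
move=> pn; elim=> [i j k nijk||x1 x2 _ -> _ ->|c x1 _ ->]; rewrite ?addr0 ?scaler0 //.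
by apply: mon_eq0; lia.
Qed.

(** Each step of the filtration is spanned, modulo the next one, by reduced
    monomials.  Their linear independence is a consequence of the pairing
    [aug_dop_mon]. *)
Lemma fil_lead n x : fil n x -> exists c : 'I_p * 'I_p * 'I_p -> K,
  fil n.+1 (x - \sum_(t : 'I_p * 'I_p * 'I_p | (t.1.1 + t.1.2 + t.2 == n)%N)
                   c t *: mon t.1.1 t.1.2 t.2).
Proof.
elim=> [i j k nijk||x1 x2 _ [c1 f1] _ [c2 f2]|a x1 _ [c f1]].
- have [/and3P[ip jp kp]|/mon_eq0 ->] := boolP [&& i < p, j < p & k < p]%N; last first.
    by exists (fun=> 0); rewrite big1 => [|t _]; rewrite ?scale0r // subrr; apply: fil0.
  exists (fun t => (t == (Ordinal ip, Ordinal jp, Ordinal kp))%:R).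
  have [eq_n|ne_n] := eqVneq (i + j + k)%N n.
    rewrite (bigD1 (Ordinal ip, Ordinal jp, Ordinal kp)) /= ?eq_n // eqxx scale1r.
    rewrite big1 ?addr0 ?subrr; first exact: fil0.
    by move=> t /andP[_ /negPf->]; rewrite scale0r.
  rewrite big1 ?subr0; first by apply: fil_mon; rewrite ltn_neqAle eq_sym ne_n.
  move=> t tn; case: eqP => [et|_]; last by rewrite scale0r.
  by rewrite et /= (negPf ne_n) in tn.
- by exists (fun=> 0); rewrite big1 => [|t _]; rewrite ?scale0r // subrr; apply: fil0.
- exists (fun t => c1 t + c2 t); under eq_bigr do rewrite scalerDl.
  by rewrite big_split /= opprD addrACA; apply: filD.
- exists (fun t => a * c t); under eq_bigr do rewrite -scalerA.
  by rewrite -scaler_sumr -scalerBr; apply: filZ.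
Qed.

End Nilpotent.

Section Derivation.
Variable D : A -> A.
Hypotheses (derD_ : is_derivation D) (fil_full : forall x, fil 0 x).

Lemma der_mon i j k : D (mon i j k) =
  mon i.-1 j k *+ i * D y1 + mon i j.-1 k *+ j * D y2 + mon i j k.-1 *+ k * D y3.
Proof. by rewrite /monomial !(derM derD_) !(der_exp derD_); ring. Qed.

Lemma fil_der n x : fil n x -> fil n.-1 (D x).
Proof.
elim=> [i j k nijk||x1 x2 _ f1 _ f2|c x1 _ f1]; last 3 first.
- by rewrite (der0 derD_); apply: fil0.
- by rewrite (derD derD_); apply: filD.
- by rewrite (derZ derD_); apply: filZ.
have filMn i' j' k' m z : (0 < m -> n.-1 <= i' + j' + k')%N ->
    fil n.-1 (mon i' j' k' *+ m * z).
  case: m => [|m] le_n; first by rewrite mulr0n mul0r; apply: fil0.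
  rewrite -scaler_nat -scalerAl; apply: filZ; rewrite -[n.-1]addn0.
  by apply: filM; [apply/fil_mon/le_n | apply: fil_full].
by rewrite der_mon; do 2?apply: filD; apply: filMn; lia.
Qed.

Lemma fil_iter_der n s x : fil n x -> fil (n - s) (iter s D x).
Proof.
move=> fx; elim: s => [|s IHs]; first by rewrite subn0.
by rewrite subnS; apply: fil_der.
Qed.

Lemma iter_derD s : {morph iter s D : x y / x + y}.
Proof. by move=> x y; elim: s => //= s ->; rewrite (derD derD_). Qed.

Lemma iter_derZ s c : {morph iter s D : x / c *: x}.
Proof. by move=> x; elim: s => //= s ->; rewrite (derZ derD_). Qed.

Lemma iter_derB s : {morph iter s D : x y / x - y}.
Proof. by move=> x y; rewrite -!scaleN1r iter_derD iter_derZ. Qed.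

(** On the associated graded algebra D acts as the constant vector field
    e1 d/dy1 + e2 d/dy2 + e3 d/dy3. *)
Lemma der_mon_lead (e1 e2 e3 : K) i j k :
  fil 1 (D y1 - e1%:A) -> fil 1 (D y2 - e2%:A) -> fil 1 (D y3 - e3%:A) ->
  fil (i + j + k) (D (mon i j k) - (e1 *: (mon i.-1 j k *+ i) +
     e2 *: (mon i j.-1 k *+ j) + e3 *: (mon i j k.-1 *+ k))).
Proof.
move=> f1 f2 f3; rewrite der_mon.
have -> (a b c a' b' c' : A) :
    a + b + c - (a' + b' + c') = (a - a') + (b - b') + (c - c') by ring.
have filMn i' j' k' m e z : (0 < m -> i + j + k <= (i' + j' + k').+1)%N ->
    fil 1 (z - e%:A) ->
    fil (i + j + k) (mon i' j' k' *+ m * z - e *: (mon i' j' k' *+ m)).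
  move=> le_n fz; rewrite -mulr_algl mulrC -mulrBl mulrC.
  case: m le_n => [|m] le_n; first by rewrite mulr0n mul0r; apply: fil0.
  rewrite -scaler_nat -scalerAl; apply: filZ.
  apply: (@fil_sub _ (i' + j' + k' + 1)); first by rewrite addn1; exact: le_n.
  by apply: filM fz; apply: fil_mon.
by apply: filD; first apply: filD; apply: filMn => //; lia.
Qed.

(** For f a family of monomials r |-> y^r m, D acts on leading terms as d/dy,
    so its iterates produce falling factorials.  The degree m is tied to
    d + i only while the coefficient c survives: once it has vanished, the
    truncated subtractions no longer compute the degree of the leading
    term. *)
Lemma iter_der_lead (f : nat -> A) (c d i m s : nat) x :
  (forall r, fil (d + r) (D (f r) - f r.-1 *+ r)) ->
  ((0 < c)%N -> m = (d + i).+1) ->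
  fil m (x - f i *+ c) ->
  fil (m - s) (iter s D x - f (i - s)%N *+ (c * i ^_ s)).
Proof.
move=> Df mc fx; elim: s => [|s IHs]; first by rewrite ffactn0 muln1 !subn0.
rewrite subnS ffactnSr mulnA [(i - s.+1)%N]subnS.
have -> : iter s.+1 D x - f (i - s).-1 *+ (c * i ^_ s * (i - s)) =
    D (iter s D x - f (i - s)%N *+ (c * i ^_ s)) +
    (c * i ^_ s)%:R *: (D (f (i - s)%N) - f (i - s).-1 *+ (i - s)).
  rewrite (derB derD_) /= -!scaler_nat (derZ derD_) scalerBr addrA subrK.
  by rewrite scalerA natrM.
apply: filD; first exact: fil_der.
have [->|] := posnP (c * i ^_ s)%N; first by rewrite scale0r; apply: fil0.
rewrite muln_gt0 ffact_gt0 => /andP[/mc -> le_si]; apply: filZ.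
by apply: fil_sub (Df _); lia.
Qed.

End Derivation.
End Filtration.

(** * Subrings and generated subalgebras *)

Section Subrings.
Variables (K : fieldType) (R : set K).

Record is_subring : Prop := {
  subring1 : R 1;
  subringB : forall a b, R a -> R b -> R (a - b);
  subringM : forall a b, R a -> R b -> R (a * b) }.

Hypothesis ringR : is_subring.

Lemma subring0 : R 0.
Proof. by rewrite -(subrr 1); apply: subringB => //; apply: subring1. Qed.

Lemma subringD a b : R a -> R b -> R (a + b).
Proof.
move=> Ra Rb; rewrite -[b]opprK; apply: (subringB ringR) => //.
by rewrite -sub0r; apply: (subringB ringR) => //; apply: subring0.
Qed.

Lemma subring_nat n : R n%:R.
Proof.
elim: n => [|n IHn]; first exact: subring0.
by rewrite -natr1; apply: subringD => //; apply: subring1.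
Qed.

(** An integer that is invertible in K has an inverse in the prime field, which
    lies in every subring. *)
Lemma subring_divn p a n : p \in [pchar K] -> n%:R != 0 :> K -> R (a *+ n) -> R a.
Proof.
move=> charK /(natr_inv_pchar charK)[m mn]; rewrite -mulr_natl => Ran.
by rewrite -[a]mul1r -mn -mulrA; apply: subringM => //; apply: subring_nat.
Qed.

Variable A : algType K.

Section Closure.
Variable B : set A.
Hypothesis algB : is_subalgebra R B.

Lemma subalg0 : B 0.
Proof. by rewrite -(subrr 1); apply: (subalgB algB); apply: subalg1 algB. Qed.

Lemma subalgD x y : B x -> B y -> B (x + y).
Proof.
move=> Bx By; rewrite -[y]opprK; apply: (subalgB algB) => //.
by rewrite -sub0r; apply: (subalgB algB) => //; apply: subalg0.
Qed.

Lemma subalgX x n : B x -> B (x ^+ n).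
Proof.
move=> Bx; elim: n => [|n IHn]; first by rewrite expr0; apply: subalg1 algB.
by rewrite exprS; apply: (subalgM algB).
Qed.

Lemma subalg_sum I (r : seq I) (P : pred I) (F : I -> A) :
  (forall i, P i -> B (F i)) -> B (\sum_(i <- r | P i) F i).
Proof.
move=> BF; elim/big_rec: _ => [|i x Pi Bx]; first exact: subalg0.
by apply: subalgD => //; apply: BF.
Qed.

Lemma subalgC c : R c -> B c%:A.
Proof. by move=> Rc; apply: (subalgZ algB) => //; apply: subalg1 algB. Qed.

End Closure.

Lemma subalgebra_genP (S : set A) : is_subalgebra R (subalgebra_gen R S).
Proof.
split=> [B [[B1 _ _ _] _]|x y Ex Ey B BS|x y Ex Ey B BS|c x Rc Ex B BS] //;
  case: (BS) => -[_ BB BM BZ] _.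
- by apply: BB; [apply: Ex | apply: Ey].
- by apply: BM; [apply: Ex | apply: Ey].
- by apply: BZ => //; apply: Ex.
Qed.

Lemma mem_subalgebra_gen (S : set A) x : S x -> subalgebra_gen R S x.
Proof. by move=> Sx; apply: sub_gen_smallest. Qed.

Lemma subalgebra_gen_sub (S B : set A) :
  is_subalgebra R B -> (forall x, S x -> B x) ->
  forall x, subalgebra_gen R S x -> B x.
Proof. by move=> algB SB; apply: smallest_sub. Qed.

End Subrings.

(** By the Leibniz rule, stability needs to be checked on generators only. *)
Lemma der_subalgebra_gen (K : fieldType) (R : set K) (A : comAlgType K)
    (S : set A) (D : A -> A) :
  is_derivation D -> (forall x, S x -> subalgebra_gen R S (D x)) ->
  forall x, subalgebra_gen R S x -> subalgebra_gen R S (D x).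
Proof.
move=> derD_ DS; set E := subalgebra_gen R S.
have algE : is_subalgebra R E := subalgebra_genP R S.
suff sub : forall z, E z -> E z /\ E (D z) by move=> x /sub[].
apply: (subalgebra_gen_sub (B := [set z | E z /\ E (D z)])) => [|z Sz]; last first.
  by split; [exact: mem_subalgebra_gen | exact: DS].
split=> /= [|x y [Ex EDx] [Ey EDy]|x y [Ex EDx] [Ey EDy]|c x Rc [Ex EDx]].
- by rewrite (der1 derD_); split; [exact: subalg1 algE | exact: subalg0 algE].
- by rewrite (derB derD_); split; apply: (subalgB algE).
- rewrite (derM derD_); split; first exact: (subalgM algE).
  by apply: (subalgD algE); apply: (subalgM algE).
- by rewrite (derZ derD_); split; apply: (subalgZ algE).
Qed.

(** * Augmentations *)

Record is_augmentation (K : fieldType) (A : algType K) (eps : A -> K) : Prop := {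
  augD : {morph eps : x y / x + y};
  augZ : forall c x, eps (c *: x) = c * eps x;
  augM : {morph eps : x y / x * y};
  aug1 : eps 1 = 1 }.

Section Augmentation.
Variables (K : fieldType) (A : algType K) (eps : A -> K).
Hypothesis augE : is_augmentation eps.

Lemma aug0 : eps 0 = 0.
Proof. by have := augZ augE 0 0; rewrite scale0r mul0r. Qed.

Lemma augB : {morph eps : x y / x - y}.
Proof. by move=> x y; rewrite (augD augE) -scaleN1r (augZ augE) mulN1r. Qed.

Lemma augMn x n : eps (x *+ n) = eps x *+ n.
Proof. by rewrite -scaler_nat (augZ augE) mulr_natl. Qed.

Lemma augX x n : eps (x ^+ n) = eps x ^+ n.
Proof.
elim: n => [|n IHn]; first by rewrite !expr0 (aug1 augE).
by rewrite !exprS (augM augE) IHn.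
Qed.

Lemma aug_sum I (r : seq I) (P : pred I) (F : I -> A) :
  eps (\sum_(i <- r | P i) F i) = \sum_(i <- r | P i) eps (F i).
Proof. exact: (big_morph eps (augD augE) aug0). Qed.

Lemma aug_subalgebra_gen (R : set K) (S : set A) :
  is_subring R -> (forall x, S x -> R (eps x)) ->
  forall x, subalgebra_gen R S x -> R (eps x).
Proof.
move=> ringR SR; apply: (@subalgebra_gen_sub _ _ _ _ [set x | R (eps x)]) => //.
split=> [|x y /= Rx Ry|x y /= Rx Ry|c x Rc /= Rx].
- by rewrite /= (aug1 augE); apply: subring1 ringR.
- by rewrite augB; apply: (subringB ringR).
- by rewrite (augM augE); apply: (subringM ringR).
- by rewrite (augZ augE); apply: (subringM ringR).
Qed.

End Augmentation.

(** * Integrality detected by derivations dual to the generators *)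

Section Duality.
Variables (K : fieldType) (p : nat) (A : comAlgType K) (R : set K).
Hypotheses (charK : p \in [pchar K]) (ringR : is_subring R).
Variables (y1 y2 y3 : A) (eps : A -> K).
Hypotheses (y1p : y1 ^+ p = 0) (y2p : y2 ^+ p = 0) (y3p : y3 ^+ p = 0).
Hypothesis augE : is_augmentation eps.
Local Notation fil := (filtration y1 y2 y3).
Local Notation mon := (monomial y1 y2 y3).
Hypothesis fil_full : forall x, fil 0 x.

Lemma aug_nilp (y : A) : y ^+ p = 0 -> eps y = 0.
Proof.
move=> /(congr1 eps); rewrite augX // aug0 // => /eqP.
by rewrite expf_eq0 => /andP[_ /eqP].
Qed.

Lemma aug_mon i j k : (0 < i + j + k)%N -> eps (mon i j k) = 0.
Proof.
move=> ijk; rewrite /monomial !(augM augE) !augX //.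
rewrite !aug_nilp // !expr0n -!natrM.
by case: i j k ijk => [|i] [|j] [|k].
Qed.

Lemma aug_fil x : fil 1 x -> eps x = 0.
Proof.
elim=> [i j k|||]; first exact: aug_mon.
- exact: aug0.
- by move=> x1 x2 _ e1 _ e2; rewrite (augD augE) e1 e2 addr0.
- by move=> c x1 _ e1; rewrite (augZ augE) e1 mulr0.
Qed.

(** Degree >= 1 is the kernel of the augmentation. *)
Lemma fil_aug x : fil 1 (x - (eps x)%:A).
Proof.
elim: (fil_full x) => [i j k _||x1 x2 _ f1 _ f2|c x1 _ f1].
- have [|ijk] := posnP (i + j + k)%N; last first.
    by rewrite [eps _]aug_mon // scale0r subr0; apply: fil_mon.
  case: i j k => [|i] [|j] [|k] // _.
  rewrite /monomial !expr0 !mulr1 (aug1 augE) scale1r subrr; exact: fil0.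
- by rewrite aug0 // scale0r subr0; apply: fil0.
- by rewrite (augD augE) scalerDl opprD addrACA; apply: filD.
- by rewrite (augZ augE) -scalerA -scalerBr; apply: filZ.
Qed.

Variables D1 D2 D3 : A -> A.
Hypotheses (derD1 : is_derivation D1) (derD2 : is_derivation D2)
           (derD3 : is_derivation D3).
Hypotheses (D1y1 : eps (D1 y1) = 1) (D1y2 : eps (D1 y2) = 0)
  (D1y3 : eps (D1 y3) = 0).
Hypotheses (D2y1 : eps (D2 y1) = 0) (D2y2 : eps (D2 y2) = 1)
  (D2y3 : eps (D2 y3) = 0).
Hypotheses (D3y1 : eps (D3 y1) = 0) (D3y2 : eps (D3 y2) = 0)
  (D3y3 : eps (D3 y3) = 1).

Definition dop i j k x := iter i D1 (iter j D2 (iter k D3 x)).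

Lemma dopB i j k : {morph dop i j k : x y / x - y}.
Proof. by move=> x y; rewrite /dop !iter_derB. Qed.

Lemma dopD i j k : {morph dop i j k : x y / x + y}.
Proof. by move=> x y; rewrite /dop !iter_derD. Qed.

Lemma dopZ i j k c : {morph dop i j k : x / c *: x}.
Proof. by move=> x; rewrite /dop !iter_derZ. Qed.

Lemma dop_fil n i j k x : fil n x -> fil (n - k - j - i) (dop i j k x).
Proof. by move=> fx; rewrite /dop; do 3?apply: fil_iter_der => //. Qed.

Lemma der_mon1 j k i :
  fil (j + k + i) (D1 (mon i j k) - mon i.-1 j k *+ i).
Proof.
have := der_mon_lead derD1 i j k (fil_aug _) (fil_aug _) (fil_aug _).
by rewrite D1y1 D1y2 D1y3 !scale0r scale1r !addr0 -addnA addnC.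
Qed.

Lemma der_mon2 i k j :
  fil (i + k + j) (D2 (mon i j k) - mon i j.-1 k *+ j).
Proof.
have := der_mon_lead derD2 i j k (fil_aug _) (fil_aug _) (fil_aug _).
by rewrite D2y1 D2y2 D2y3 !scale0r scale1r addr0 add0r addnAC.
Qed.

Lemma der_mon3 i j k :
  fil (i + j + k) (D3 (mon i j k) - mon i j k.-1 *+ k).
Proof.
have := der_mon_lead derD3 i j k (fil_aug _) (fil_aug _) (fil_aug _).
by rewrite D3y1 D3y2 D3y3 !scale0r scale1r !add0r.
Qed.

(** In equal total degree the error terms end up in degree >= 1, where eps
    vanishes; the leading terms are those of partial differentiation. *)
Lemma aug_dop_mon i j k i' j' k' : (i + j + k = i' + j' + k')%N ->
  eps (dop i j k (mon i' j' k')) =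
  eps (mon (i' - i) (j' - j) (k' - k)) *+ (k' ^_ k * j' ^_ j * i' ^_ i).
Proof.
move=> eq_n; set n := (i + j + k)%N.
pose step := @iter_der_lead _ _ y1 y2 y3.
have f3 := step D3 derD3 fil_full (mon i' j') 1%N (i' + j')%N k' n.+1 k
  (mon i' j' k') (der_mon3 i' j').
have f2 := step D2 derD2 fil_full (fun r => mon i' r (k' - k)) (1 * k' ^_ k)%N
  (i' + (k' - k))%N j' (n.+1 - k)%N j (iter k D3 (mon i' j' k'))
  (der_mon2 i' (k' - k)).
have f1 := step D1 derD1 fil_full (fun r => mon r (j' - j) (k' - k))
  (1 * k' ^_ k * j' ^_ j)%N (j' - j + (k' - k))%N i' (n.+1 - k - j)%N i
  (iter j D2 (iter k D3 (mon i' j' k'))) (der_mon1 (j' - j) (k' - k)).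
have {f1 f2 f3 step} : fil 1 (dop i j k (mon i' j' k') -
    mon (i' - i) (j' - j) (k' - k) *+ (1 * k' ^_ k * j' ^_ j * i' ^_ i)).
  have n1 : (n.+1 - k - j - i = 1)%N by rewrite /n; lia.
  rewrite n1 in f1; apply: f1; first by rewrite !muln_gt0 !ffact_gt0 /n; lia.
  apply: f2; first by rewrite !muln_gt0 !ffact_gt0 /n; lia.
  apply: f3; first by rewrite /n; lia.
  by rewrite subrr; apply: fil0.
move/aug_fil/eqP; rewrite augB // subr_eq0 => /eqP ->.
by rewrite augMn // mul1n.
Qed.

Lemma aug_dop_mon_diag i j k :
  eps (dop i j k (mon i j k)) = (k`! * j`! * i`!)%:R.
Proof.
rewrite aug_dop_mon // !subnn !ffactnn /monomial !expr0 !mulr1.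
by rewrite (aug1 augE).
Qed.

(** Two distinct exponents of the same total degree differ by a decrease
    somewhere, which makes one of the falling factorials vanish. *)
Lemma aug_dop_mon_off i j k i' j' k' : (i + j + k = i' + j' + k')%N ->
  (i, j, k) != (i', j', k') -> eps (dop i j k (mon i' j' k')) = 0.
Proof.
move=> eq_n ne; rewrite aug_dop_mon //.
suff -> : (k' ^_ k * j' ^_ j * i' ^_ i = 0)%N by [].
apply/eqP; rewrite !muln_eq0 -orbA; apply/or3P.
have : [|| k' < k, j' < j | i' < i]%N by move: ne; rewrite !xpair_eqE; lia.
by case/or3P => lt; [constructor 1 | constructor 2 | constructor 3]; rewrite ffact_small.
Qed.

(** The leading coefficients of x modulo E are recovered, up to the units
    i! j! k!, by the operators D1^i D2^j D3^k; so they are integral, and x can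
    be corrected by an element of E degree by degree. *)
Lemma mem_subalgebra_gen_dop x :
  let E := subalgebra_gen R [set y1; y2; y3] in
  (forall i j k e, E e -> R (eps (dop i j k e))) ->
  (forall i j k, R (eps (dop i j k x))) -> E x.
Proof.
move=> E E_int x_int.
have algE : is_subalgebra R E := subalgebra_genP R _.
have Ey1 : E y1 by apply: mem_subalgebra_gen; left; left.
have Ey2 : E y2 by apply: mem_subalgebra_gen; left; right.
have Ey3 : E y3 by apply: mem_subalgebra_gen; right.
have Emon i j k : E (mon i j k).
  by do 2?apply: (subalgM algE); apply: (subalgX algE).
suff approx n : exists2 e, E e & fil n (x - e).
  have [e Ee /(fil_eq0 y1p y2p y3p (leqnn _))/eqP] := approx (3 * p)%N.
  by rewrite subr_eq0 => /eqP ->.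
elim: n => [|n [e Ee fz]]; first by exists 0; [exact: subalg0 algE | exact: fil_full].
have [c fz1] := fil_lead y1p y2p y3p fz.
suff Rc (t : 'I_p * 'I_p * 'I_p) : (t.1.1 + t.1.2 + t.2)%N = n -> R (c t).
  exists (e + \sum_(t : 'I_p * 'I_p * 'I_p | (t.1.1 + t.1.2 + t.2 == n)%N)
               c t *: mon t.1.1 t.1.2 t.2); last by rewrite opprD addrA.
  apply: (subalgD algE) => //; apply: (subalg_sum algE) => t /eqP tn.
  by apply: (subalgZ algE) => //; apply: Rc.
case: t => -[i j] k /= ijk.
have f_gt0 : (k`! * j`! * i`!)%:R != 0 :> K.
  by rewrite !natrM !mulf_neq0 // (fact_pchar_neq0 charK).
apply: (subring_divn ringR charK f_gt0).
have : R (eps (dop i j k (x - e))).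
  by rewrite dopB augB //; apply: (subringB ringR); [apply: x_int | apply: E_int].
have {fz1} : eps (dop i j k (x - e - \sum_(t : 'I_p * 'I_p * 'I_p |
    (t.1.1 + t.1.2 + t.2 == n)%N) c t *: mon t.1.1 t.1.2 t.2)) = 0.
  apply: aug_fil; have -> : 1%N = (n.+1 - k - j - i)%N by rewrite -ijk; lia.
  exact: dop_fil.
rewrite [dop _ _ _ (_ - \sum_(_ | _) _)]dopB augB // => /eqP.
rewrite subr_eq0 => /eqP ->.
have dop0 : dop i j k 0 = 0 by have := dopZ i j k 0 0; rewrite !scale0r.
rewrite (big_morph _ (dopD i j k) dop0) aug_sum //.
rewrite (bigD1 (i, j, k)) /= ?ijk ?eqxx // dopZ (augZ augE) aug_dop_mon_diag.
rewrite big1 ?addr0 ?mulr_natr // => -[[i' j'] k'] /= /andP[/eqP ijk' ne].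
rewrite dopZ (augZ augE) aug_dop_mon_off ?mulr0 // ?ijk ?ijk' //.
by rewrite eq_sym; move: ne; rewrite !xpair_eqE.
Qed.

End Duality.

(** * Twisted generators and their logarithmic derivatives *)

Section TwistedGenerators.
Variables (K : fieldType) (p : nat) (A : comAlgType K) (R : set K).
Hypotheses (charK : p \in [pchar K]) (ringR : is_subring R).
Variables (g1 g2 g3 : A) (mu alpha beta r1 r2 r3 : K).
Hypotheses (g1p : g1 ^+ p = 1) (g2p : g2 ^+ p = 1) (g3p : g3 ^+ p = 1).
Hypotheses (r1_neq0 : r1 != 0) (r2_neq0 : r2 != 0) (r3_neq0 : r3 != 0).

Let x1 := g1.
Let x2 := g2 * trunc_exp p x1 mu.
Let x3 := g3 * trunc_exp p x1 alpha * trunc_exp p x2 beta.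
Let y1 := r1^-1 *: (x1 - 1).
Let y2 := r2^-1 *: (x2 - 1).
Let y3 := r3^-1 *: (x3 - 1).

Let p_gt1 : (1 < p)%N := prime_gt1 (pcharf_prime charK).

Lemma twisted_order1 : x1 ^+ p = 1. Proof. exact: g1p. Qed.

Lemma twisted_order2 : x2 ^+ p = 1.
Proof. by rewrite exprMn g2p mul1r trunc_exp_order. Qed.

Lemma twisted_order3 : x3 ^+ p = 1.
Proof.
by rewrite !exprMn g3p mul1r !trunc_exp_order ?mulr1 // twisted_order2.
Qed.

Lemma scaled_nilpotent r (x : A) : x ^+ p = 1 -> (r *: (x - 1)) ^+ p = 0.
Proof. by move=> xp; rewrite exprZn (exp_unipotent charK xp) scaler0. Qed.

Lemma twisted_unscale r (x : A) : r != 0 -> x = 1 + r *: (r^-1 *: (x - 1)).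
Proof. by move=> r0; rewrite scalerA divff // scale1r addrC subrK. Qed.

Lemma fil_trunc_exp x b : filtration y1 y2 y3 0 x ->
  filtration y1 y2 y3 0 (trunc_exp p x b).
Proof.
move=> fx; apply: fil_sum => m _; apply/filZ/fil0X/filB => //.
exact: fil1.
Qed.

(** A truncated exponential w has w^p = 1, so the twists are undone by
    multiplication with w^(p-1): the y's generate the same algebra as the
    g's. *)
Lemma fil_twisted : [/\ filtration y1 y2 y3 0 g1,
  filtration y1 y2 y3 0 g2 & filtration y1 y2 y3 0 g3].
Proof.
have fil_x r y x : r != 0 -> y = r^-1 *: (x - 1) -> filtration y1 y2 y3 1 y ->
    filtration y1 y2 y3 0 x.
  move=> r0 -> fy; rewrite (twisted_unscale x r0); apply: filD; first exact: fil1.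
  by apply: filZ; apply: fil_sub fy.
have f1 : filtration y1 y2 y3 0 g1 := fil_x r1 y1 x1 r1_neq0 erefl (fil_gen1 _ _ _).
have f2 : filtration y1 y2 y3 0 x2 := fil_x r2 y2 x2 r2_neq0 erefl (fil_gen2 _ _ _).
have f3 : filtration y1 y2 y3 0 x3 := fil_x r3 y3 x3 r3_neq0 erefl (fil_gen3 _ _ _).
have cancel_te (x g : A) b : x ^+ p = 1 ->
    g = g * trunc_exp p x b * trunc_exp p x b ^+ p.-1.
  move=> xp; rewrite -mulrA -exprS (prednK (ltnW p_gt1)).
  by rewrite trunc_exp_order // mulr1.
split=> //.
  rewrite (cancel_te x1 g2 mu g1p); apply: fil0M => //.
  exact/fil0X/fil_trunc_exp.
rewrite (cancel_te x1 g3 alpha g1p); apply: fil0M; last exact/fil0X/fil_trunc_exp.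
rewrite (cancel_te x2 (_ * _) beta twisted_order2); apply: fil0M => //.
exact/fil0X/fil_trunc_exp.
Qed.

(* The c's are the values of an additive function on g1, g2, g3, and the e's
   its coordinates in the basis dual to y1, y2, y3 modulo degree 2. *)
Variable D : A -> A.
Variables c1 c2 c3 e1 e2 e3 : K.
Hypotheses (derD_ : is_derivation D)
  (Dg1 : D g1 = c1 *: g1) (Dg2 : D g2 = c2 *: g2) (Dg3 : D g3 = c3 *: g3).
Hypotheses (c1E : c1 = r1 * e1) (c2E : c2 + mu * c1 = r2 * e2)
  (c3E : c3 + alpha * c1 + beta * (c2 + mu * c1) = r3 * e3).

Let P := y1 ^+ p.-1.
Let Q := y2 ^+ p.-1.

(* The logarithmic derivatives of x1, x2, x3, expanded in powers of the
   generators y1, y2. *)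
Let u1 : A := c1%:A.
Let u2 : A := (c2 + mu * c1)%:A + (c1 * wp p mu * r1 ^+ p.-1) *: P.
Let u3 : A := (c3 + alpha * c1 + beta * (c2 + mu * c1))%:A
  + (c1 * (wp p alpha + wp p mu * beta) * r1 ^+ p.-1) *: P
  + ((c2 + mu * c1) * wp p beta * r2 ^+ p.-1) *: Q
  + (c1 * wp p mu * wp p beta * r1 ^+ p.-1 * r2 ^+ p.-1) *: (P * Q).

Let scaleE (a : K) (x : A) : a *: x = in_alg A a * x.
Proof. by rewrite mulr_algl. Qed.

Let socle (r : K) (x : A) : r != 0 ->
  (x - 1) ^+ p.-1 = r ^+ p.-1 *: (r^-1 *: (x - 1)) ^+ p.-1.
Proof. by move=> r0; rewrite -exprZn scalerA divff // scale1r. Qed.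

Lemma dlog_twisted1 : D x1 = u1 * x1.
Proof. by rewrite Dg1 mulr_algl. Qed.

Lemma dlog_twisted2 : D x2 = u2 * x2.
Proof.
have te := dlog_trunc_exp charK mu derD_ dlog_twisted1 (exp_unipotent charK g1p).
have Dg2' : D g2 = c2%:A * g2 by rewrite Dg2 mulr_algl.
rewrite (dlog_mul derD_ Dg2' te); congr (_ * _).
rewrite (socle x1 r1_neq0) -/y1 -/P /u1 /u2 !scaleE.
by ring.
Qed.

Lemma dlog_twisted3 : D x3 = u3 * x3.
Proof.
have te1 := dlog_trunc_exp charK alpha derD_ dlog_twisted1 (exp_unipotent charK g1p).
have te2 := dlog_trunc_exp charK beta derD_ dlog_twisted2
  (exp_unipotent charK twisted_order2).
have Dg3' : D g3 = c3%:A * g3 by rewrite Dg3 mulr_algl.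
rewrite (dlog_mul derD_ (dlog_mul derD_ Dg3' te1) te2); congr (_ * _).
rewrite (socle x1 r1_neq0) (socle x2 r2_neq0) -/y1 -/y2 -/P -/Q /u1 /u2 /u3.
by rewrite !scaleE; ring.
Qed.

Hypotheses (R_r1 : R r1) (R_r2 : R r2) (R_r3 : R r3).
Hypotheses (R_mu : R (r1 ^+ p * r2^-1 * wp p mu))
  (R_alpha : R (r1 ^+ p * r3^-1 * (wp p alpha + wp p mu * beta)))
  (R_beta : R (r2 ^+ p * r3^-1 * wp p beta)).
Hypotheses (R_e1 : R e1) (R_e2 : R e2) (R_e3 : R e3).

Lemma der_scaled r (x : A) u : D x = u * x ->
  D (r^-1 *: (x - 1)) = (r^-1 *: u) * x.
Proof.
move=> Dx; rewrite (derZ derD_) (derB derD_) (der1 derD_) subr0 Dx.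
exact: scalerAl.
Qed.

(** In the coefficients of u2 and u3 divided by r2 and r3, each factor
    r^(p-1) coming from a power y^(p-1) combines with the r in c1 = r1 e1 or
    c2 + mu c1 = r2 e2 to r^p, which is what the integrality hypotheses
    provide.  The cross term is a product of two of them. *)
Lemma der_twisted_order :
  let E := subalgebra_gen R [set y1; y2; y3] in
  [/\ E (D y1), E (D y2) & E (D y3)].
Proof.
move=> E; have algE : is_subalgebra R E := subalgebra_genP R _.
have Ey1 : E y1 by apply: mem_subalgebra_gen; left; left.
have Ey2 : E y2 by apply: mem_subalgebra_gen; left; right.
have Ey3 : E y3 by apply: mem_subalgebra_gen; right.
have EP : E P by apply: (subalgX algE).
have EQ : E Q by apply: (subalgX algE).
have Ex r (x : A) : r != 0 -> R r -> E (r^-1 *: (x - 1)) -> E x.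
  move=> r0 Rr Ey; rewrite (twisted_unscale x r0).
  by apply: (subalgD algE); [exact: subalg1 algE | exact: (subalgZ algE)].
have powp (r : K) : r ^+ p = r * r ^+ p.-1 by rewrite -exprS (prednK (ltnW p_gt1)).
move: (R_mu) (R_alpha) (R_beta); rewrite (powp r1) (powp r2) => Rm Ra Rb.
split.
- rewrite (der_scaled _ dlog_twisted1); apply: (subalgM algE); last exact: Ex Ey1.
  rewrite scalerA; apply: (subalgC algE); rewrite c1E.
  by rewrite mulKf.
- rewrite (der_scaled _ dlog_twisted2); apply: (subalgM algE); last exact: Ex Ey2.
  rewrite scalerDr !scalerA; apply: (subalgD algE).
    by apply: (subalgC algE); rewrite c2E mulKf.
  apply: (subalgZ algE) => //; rewrite c1E.
  have -> : r2^-1 * (r1 * e1 * wp p mu * r1 ^+ p.-1) =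
    e1 * (r1 * r1 ^+ p.-1 * r2^-1 * wp p mu) by ring.
  exact: (subringM ringR).
- rewrite (der_scaled _ dlog_twisted3); apply: (subalgM algE); last exact: Ex Ey3.
  rewrite !scalerDr !scalerA c3E c2E c1E.
  apply: (subalgD algE); [apply: (subalgD algE); [apply: (subalgD algE)|]|].
  + by apply: (subalgC algE); rewrite mulKf.
  + apply: (subalgZ algE) => //.
    have -> : r3^-1 * (r1 * e1 * (wp p alpha + wp p mu * beta) * r1 ^+ p.-1) =
      e1 * (r1 * r1 ^+ p.-1 * r3^-1 * (wp p alpha + wp p mu * beta)) by ring.
    exact: (subringM ringR).
  + apply: (subalgZ algE) => //.
    have -> : r3^-1 * (r2 * e2 * wp p beta * r2 ^+ p.-1) =
      e2 * (r2 * r2 ^+ p.-1 * r3^-1 * wp p beta) by ring.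
    exact: (subringM ringR).
  + apply: (subalgZ algE); last exact: (subalgM algE).
    have -> : r3^-1 * (r1 * e1 * wp p mu * wp p beta * r1 ^+ p.-1 * r2 ^+ p.-1) =
      e1 * (r1 * r1 ^+ p.-1 * r2^-1 * wp p mu) *
      (r2 * r2 ^+ p.-1 * r3^-1 * wp p beta) by field; rewrite r2_neq0 r3_neq0.
    by apply: (subringM ringR) => //; apply: (subringM ringR).
Qed.

(** The powers P and Q have augmentation 0, so that only the constant terms of
    the logarithmic derivatives survive. *)
Lemma aug_der_twisted (eps : A -> K) : is_augmentation eps ->
  [/\ eps (D y1) = e1, eps (D y2) = e2 & eps (D y3) = e3].
Proof.
move=> augE.
have eps0 (y : A) : y ^+ p = 0 -> eps (y ^+ p.-1) = 0.
  move=> /(aug_nilp augE); rewrite (augX augE) => ->.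
  by rewrite expr0n; case: p p_gt1 => [|[|]].
have epsP : eps P = 0 by apply/eps0/scaled_nilpotent/twisted_order1.
have epsQ : eps Q = 0 by apply/eps0/scaled_nilpotent/twisted_order2.
have epsx (x : A) : x ^+ p = 1 -> eps x = 1.
  move=> /(scaled_nilpotent 1)/(aug_nilp augE)/eqP.
  by rewrite scale1r (augB augE) (aug1 augE) subr_eq0 => /eqP.
have epsD r (x u : A) : x ^+ p = 1 -> D x = u * x ->
    eps (D (r^-1 *: (x - 1))) = r^-1 * eps u.
  by move=> /epsx ex Dx; rewrite (der_scaled _ Dx) (augM augE) ex mulr1 (augZ augE).
rewrite (epsD _ _ _ twisted_order1 dlog_twisted1).
rewrite (epsD _ _ _ twisted_order2 dlog_twisted2).
rewrite (epsD _ _ _ twisted_order3 dlog_twisted3) /u1 /u2 /u3.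
rewrite !(augD augE) !(augZ augE) !(augM augE) epsP epsQ (aug1 augE).
by rewrite !mulr0 !addr0 !mulr1 c3E c2E c1E !mulKf.
Qed.

End TwistedGenerators.

(** * Primitive functionals *)

Section PrimitiveFunctional.
Variables (K : fieldType) (p : nat) (A : comAlgType K) (y1 y2 y3 : A).
Variables (eps phi : A -> K).
Hypotheses (y1p : y1 ^+ p = 0) (y2p : y2 ^+ p = 0) (y3p : y3 ^+ p = 0).
Hypotheses (augE : is_augmentation eps)
           (fil_full : forall x, filtration y1 y2 y3 0 x).
Hypotheses (phiD : {morph phi : x y / x + y})
           (phiZ : forall c x, phi (c *: x) = c * phi x).
Hypotheses (phi1 : phi 1 = 0)
  (phi2 : forall i j k, (i < p)%N -> (j < p)%N -> (k < p)%N ->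
          (2 <= i + j + k)%N -> phi (y1 ^+ i * y2 ^+ j * y3 ^+ k) = 0).

(** The product of x - eps x and y - eps y has degree >= 2, so phi kills it. *)
Lemma primitive_functional x y : phi (x * y) = phi x * eps y + eps x * phi y.
Proof.
have phi0 : phi 0 = 0 by have := phiZ 0 0; rewrite scale0r mul0r.
have phi_fil z : filtration y1 y2 y3 2 z -> phi z = 0.
  elim=> [i j k ijk||z1 z2 _ f1 _ f2|c z1 _ f1]; rewrite ?phi0 //.
  - have [/and3P[ip jp kp]|/(mon_eq0 y1p y2p y3p) ->] :=
      boolP [&& i < p, j < p & k < p]%N; [exact: phi2 | exact: phi0].
  - by rewrite phiD f1 f2 addr0.
  - by rewrite phiZ f1 mulr0.
have := phi_fil _ (filM (fil_aug y1p y2p y3p augE fil_full x)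
                        (fil_aug y1p y2p y3p augE fil_full y)).
have -> : (x - (eps x)%:A) * (y - (eps y)%:A) =
    x * y + ((- eps y) *: x + ((- eps x) *: y + (eps x * eps y) *: 1)).
  have scaleE (a : K) (z : A) : a *: z = in_alg A a * z by rewrite mulr_algl.
  by rewrite !scaleE; ring.
rewrite !phiD !phiZ phi1 mulr0 addr0 => h.
by apply/eqP; rewrite -subr_eq0 -h; apply/eqP; ring.
Qed.

End PrimitiveFunctional.

(** * The group algebra and the action of its dual *)

Section GroupAlgebraFacts.
Variables (K : fieldType) (gT : finGroupType).
Local Notation gelt := (gelt K).

Lemma geltM (g h : gT) : gelt (g * h)%g = gelt g * gelt h :> galg K gT.
Proof.
apply/ffunP=> k; rewrite !ffunE (bigD1 g) //= !ffunE eqxx mul1r.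
rewrite big1 ?addr0; last by move=> l /negPf lg; rewrite ffunE lg mul0r.
by rewrite -[in RHS](inj_eq (mulgI g)) mulKVg.
Qed.

Lemma geltX (g : gT) n : gelt (g ^+ n)%g = gelt g ^+ n :> galg K gT.
Proof. by elim: n => [|n IHn] //; rewrite expgS exprS geltM IHn. Qed.

Lemma galg_mulC : abelian [set: gT]%SET ->
  commutative (fun x y : galg K gT => x * y).
Proof.
move=> abG x y; rewrite (galg_basis x) (galg_basis y).
rewrite !mulr_suml; under eq_bigr do rewrite mulr_sumr.
rewrite exchange_big /=; apply: eq_bigr => h _; rewrite mulr_sumr.
apply: eq_bigr => g _; rewrite -!scalerAl -!scalerAr !scalerA -!geltM.
by rewrite [x g * _]mulrC (centsP abG) ?inE.
Qed.

Lemma pairingDr (f : gdual K gT) : {morph pairing f : x y / x + y}.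
Proof. by move=> x y; rewrite /pairing linearD. Qed.

Lemma pairingZr (f : gdual K gT) c x : pairing f (c *: x) = c * pairing f x.
Proof. by rewrite /pairing linearZ. Qed.

Definition aug (x : galg K gT) : K := \sum_g x g.

Lemma aug_gelt g : aug (gelt g) = 1.
Proof.
rewrite /aug (bigD1 g) //= ffunE eqxx big1 ?addr0 // => h /negPf hg.
by rewrite ffunE hg.
Qed.

Lemma augmentation_aug : is_augmentation aug.
Proof.
have addD : {morph aug : x y / x + y}.
  by move=> x y; rewrite /aug -big_split; apply: eq_bigr => g _; rewrite ffunE.
have scaleZ c x : aug (c *: x) = c * aug x.
  by rewrite /aug big_distrr; apply: eq_bigr => g _; rewrite ffunE.
split=> // [x y|]; last exact: aug_gelt.
rewrite /aug big_distrl /=; under eq_bigr do rewrite ffunE.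
rewrite exchange_big /=; apply: eq_bigr => h _.
by rewrite -big_distrr /= (reindex_inj (mulgI h)); under eq_bigr do rewrite mulKg.
Qed.

(** The transpose of multiplication by f: <h f, x> = <h, f . x>.  Pairings with
    products thereby become compositions of operators on K[G]. *)
Definition gdual_act (f : gdual K gT) (x : galg K gT) : galg K gT :=
  [ffun g => pairing f (gelt g) * x g].

Lemma pairing_gdual_act f x : pairing f x = aug (gdual_act f x).
Proof.
rewrite {1}(galg_basis x) /pairing linear_sum; apply: eq_bigr => g _.
by rewrite linearZ /= ffunE mulrC.
Qed.

Lemma gdual_act1 x : gdual_act 1 x = x.
Proof. by apply/ffunP => g; rewrite ffunE pairing_one mul1r. Qed.

Lemma gdual_actM f1 f2 x : gdual_act (f1 * f2) x = gdual_act f1 (gdual_act f2 x).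
Proof. by apply/ffunP => g; rewrite !ffunE pairing_mul mulrA. Qed.

Lemma gdual_actD f1 f2 x : gdual_act (f1 + f2) x = gdual_act f1 x + gdual_act f2 x.
Proof. by apply/ffunP => g; rewrite !ffunE pairingDl mulrDl. Qed.

Lemma gdual_actZ a f x : gdual_act (a *: f) x = a *: gdual_act f x.
Proof. by apply/ffunP => g; rewrite !ffunE pairingZl -mulrA. Qed.

Lemma gdual_actB f1 f2 x : gdual_act (f1 - f2) x = gdual_act f1 x - gdual_act f2 x.
Proof. by rewrite gdual_actD -!scaleN1r gdual_actZ. Qed.

Lemma gdual_actX f n x : gdual_act (f ^+ n) x = iter n (gdual_act f) x.
Proof. by elim: n => [|n IHn]; rewrite ?gdual_act1 // exprS gdual_actM IHn. Qed.

Lemma gdual_act_gelt f g : gdual_act f (gelt g) = pairing f (gelt g) *: gelt g.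
Proof.
apply/ffunP => h; rewrite !ffunE.
by have [->|] := eqVneq h g; rewrite // mulr0 [_ *: _]mulr0.
Qed.

(** The group elements that lie in B form a submonoid, which is a subgroup as G
    is finite. *)
Lemma gelt_generate (B : set (galg K gT)) (S : {set gT}) :
  is_subalgebra setT B -> <<S>>%g = [set: gT]%SET ->
  (forall g, g \in S -> B (gelt g)) -> forall x, B x.
Proof.
move=> algB genS BS x.
pose H := [set g | `[< B (gelt g) >]]%SET.
have inH g : (g \in H) = `[< B (gelt g) >] by rewrite inE.
have gH : group_set H.
  apply/group_setP; split=> [|g h]; rewrite !inH.
    by apply/asboolP; exact: subalg1 algB.
  by move=> /asboolP Bg /asboolP Bh; apply/asboolP; rewrite geltM; apply: (subalgM algB).
have: <<S>>%g \subset Group gH.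
  by rewrite gen_subG; apply/fintype.subsetP => g /BS Bg; rewrite inH; apply/asboolP.
move=> /fintype.subsetP BG; rewrite (galg_basis x); apply: (subalg_sum algB) => g _.
apply: (subalgZ algB) => //; apply/asboolP; rewrite -inH; apply: BG.
by rewrite genS inE.
Qed.

End GroupAlgebraFacts.

Definition additive_on (K : fieldType) (gT : finGroupType) (f : gdual K gT) :=
  forall g h : gT,
    pairing f (gelt K (g * h)%g) = pairing f (gelt K g) + pairing f (gelt K h).

Section AdditiveFunctions.
Variables (K : fieldType) (gT : finGroupType).
Implicit Types f : gdual K gT.

Lemma pairingBl f1 f2 x : pairing (f1 - f2) x = pairing f1 x - pairing f2 x.
Proof. by rewrite pairingDl -scaleN1r pairingZl mulN1r. Qed.

Lemma additive_onZ a f : additive_on f -> additive_on (a *: f).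
Proof. by move=> fM g h; rewrite !pairingZl fM mulrDr. Qed.

Lemma additive_onB f1 f2 :
  additive_on f1 -> additive_on f2 -> additive_on (f1 - f2).
Proof. by move=> f1M f2M g h; rewrite !pairingBl f1M f2M; ring. Qed.

Hypothesis abG : abelian [set: gT]%SET.

(** The same algebra with its commutativity recorded in the type, so that the
    results on commutative algebras apply. *)
Definition comm_galg : comAlgType K := HB.pack (galg K gT)
  (GRing.PzRing_hasCommutativeMul.Build (galg K gT) (galg_mulC abG)).

(** Leibniz rule on group elements: f(gh) gh = (f(g) g) h + g (f(h) h). *)
Lemma gdual_act_derivation f :
  additive_on f -> @is_derivation K comm_galg (gdual_act f).
Proof.
move=> fM; split=> [x y|c x|x y].
- by apply/ffunP => g; rewrite !ffunE mulrDr.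
- by apply/ffunP => g; rewrite !ffunE; apply: mulrCA.
- apply/ffunP => g; rewrite !ffunE -big_split big_distrr; apply: eq_bigr => h _ /=.
  by rewrite !ffunE -{1}(mulKVg h g) fM; ring.
Qed.

End AdditiveFunctions.

(** * The valuation ring *)

Section ValuationRing.
Variables (K : fieldType) (v : K -> \bar int).
Hypothesis valv : discrete_valuation v.

Lemma val_fin x : x != 0 -> exists n : int, v x = n%:E.
Proof. by move=> /(dval_fin valv); case: (v x) => // n _; exists n. Qed.

Lemma val1 : v 1 = 0%:E.
Proof.
have [n vn] := val_fin (oner_neq0 K).
have := dvalM valv 1 1; rewrite mulr1 vn -EFinD => -[] /eqP.
by rewrite -subr_eq0 opprD addNKr oppr_eq0 => /eqP ->.
Qed.

Lemma valN x : v (- x) = v x.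
Proof.
have N1_neq0 : -1 != 0 :> K by rewrite oppr_eq0 oner_eq0.
have [n vn] := val_fin N1_neq0.
have := dvalM valv (-1) (-1); rewrite mulrNN mulr1 val1 vn -EFinD => -[] eqn.
have -> : - x = -1 * x by rewrite mulN1r.
by rewrite (dvalM valv) vn (_ : n = 0) ?add0e //; lia.
Qed.

Lemma valuation_subring : is_subring (valuation_ring v).
Proof.
split; rewrite /valuation_ring /= ?val1 // => a b va vb.
  apply: le_trans (dvalD valv _ _); rewrite valN.
  by rewrite le_min va.
by rewrite (dvalM valv) adde_ge0.
Qed.

Variable pi : K.
Hypothesis vpi : v pi = 1%:E.

Lemma uniformizer_neq0 : pi != 0.
Proof. by apply/eqP => pi0; move: vpi; rewrite pi0 (dval0 valv). Qed.

Lemma valX n : v (pi ^+ n) = (n%:Z)%:E.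
Proof.
elim: n => [|n IHn]; first by rewrite expr0 val1.
by rewrite exprS (dvalM valv) vpi IHn -EFinD -intS.
Qed.

Lemma valuation_ringX n : valuation_ring v (pi ^+ n).
Proof. by rewrite /valuation_ring /= valX lee_fin. Qed.

Lemma valuation_ring_scale (a b : nat) x :
  ((a%:Z - b%:Z)%:E <= v x)%E -> valuation_ring v (pi ^+ b * (pi ^+ a)^-1 * x).
Proof.
have pia : (pi ^+ a)^-1 != 0 by rewrite invr_eq0 expf_neq0 // uniformizer_neq0.
have [n vn] := val_fin pia.
have := dvalM valv (pi ^+ a) (pi ^+ a)^-1.
rewrite divff ?expf_neq0 ?uniformizer_neq0 // val1 valX vn -EFinD => -[] eqn le_ab.
rewrite /valuation_ring /= !(dvalM valv) valX vn.
case: (v x) le_ab => [m| |] //.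
by rewrite -!EFinD !lee_fin => le_ab; lia.
Qed.

End ValuationRing.

Lemma filtration_subalgebra (K : fieldType) (A : comAlgType K) (y1 y2 y3 : A) :
  is_subalgebra setT (filtration y1 y2 y3 0).
Proof.
split=> [|x y|x y|c x _]; [exact: fil1 | exact: filB | exact: fil0M | exact: filZ].
Qed.

Close Scope classical_set_scope.

(** * Elementary abelian groups *)

Section ElementaryAbelian.
Variables (p : nat) (K : fieldType) (gT : finGroupType) (g1 g2 g3 : gT).
Hypothesis abG : abelian [set: gT].
Hypotheses (charK : p \in [pchar K]) (abelemG : (p.-abelem [set: gT])%g)
  (genG : (<<[set g1; g2; g3]>> = [set: gT])%g).

Local Notation A := (comm_galg K abG).

Let p_gt1 : (1 < p)%N := prime_gt1 (pcharf_prime charK).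

Lemma gelt_exp_prime g : (gelt K g : A) ^+ p = 1.
Proof.
have [_ _ expG] := and3P abelemG.
rewrite -[_ ^+ p]geltX (_ : g ^+ p = 1)%g //.
by move/exponentP: expG => -> //; rewrite inE.
Qed.

Lemma filtration_full (z1 z2 z3 : A) :
  filtration z1 z2 z3 0 (gelt K g1 : A) ->
  filtration z1 z2 z3 0 (gelt K g2 : A) ->
  filtration z1 z2 z3 0 (gelt K g3 : A) ->
  forall x, filtration z1 z2 z3 0 x.
Proof.
move=> f1 f2 f3.
apply: (gelt_generate (filtration_subalgebra z1 z2 z3) genG) => g.
by rewrite !inE -orbA => /or3P[] /eqP ->.
Qed.

Lemma xi_gen a b c (xi : gdual K gT) :
  is_xi p g1 g2 g3 a b c xi -> (a + b + c = 1)%N ->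
  [/\ pairing xi (gelt K g1) = a%:R, pairing xi (gelt K g2) = b%:R
    & pairing xi (gelt K g3) = c%:R].
Proof.
move=> xiP abc; have p_gt0 := ltnW p_gt1.
have xi1 : pairing xi 1 = 0.
  have := xiP 0%N 0%N 0%N p_gt0 p_gt0 p_gt0; rewrite !expr0 !mulr1 => ->.
  by rewrite -!natrM; case: a b c abc {xiP} => [|[|a]] [|[|b]] [|[|c]].
have xiB g : pairing xi (gelt K g) = pairing xi (gelt K g - 1).
  by rewrite [RHS]/pairing linearB /= -/(pairing xi 1) xi1 subr0.
rewrite !xiB; split.
- have := xiP 1%N 0%N 0%N p_gt1 p_gt0 p_gt0; rewrite expr1 !expr0 !mulr1 => ->.
  by rewrite -!natrM; case: a b c abc {xiP} => [|[|a]] [|[|b]] [|[|c]].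
- have := xiP 0%N 1%N 0%N p_gt0 p_gt1 p_gt0; rewrite expr1 !expr0 mulr1 mul1r => ->.
  by rewrite -!natrM; case: a b c abc {xiP} => [|[|a]] [|[|b]] [|[|c]].
- have := xiP 0%N 0%N 1%N p_gt0 p_gt0 p_gt1; rewrite expr1 !expr0 !mul1r => ->.
  by rewrite -!natrM; case: a b c abc {xiP} => [|[|a]] [|[|b]] [|[|c]].
Qed.

(** A functional dual to a degree one monomial kills 1 and degree >= 2, hence
    is primitive; on group elements, whose augmentation is 1, this is
    additivity. *)
Lemma xi_additive a b c (xi : gdual K gT) :
  is_xi p g1 g2 g3 a b c xi -> (a + b + c = 1)%N -> additive_on xi.
Proof.
move=> xiP abc g h.
pose X g : A := gelt K g - 1.
have Xp k : X k ^+ p = 0 by apply: exp_unipotent => //; apply: gelt_exp_prime.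
have f_unit (k : gT) z1 z2 z3 : filtration z1 z2 z3 1 (X k) ->
    filtration z1 z2 z3 0 (gelt K k : A).
  move=> fX; have -> : (gelt K k : A) = 1 + X k by rewrite addrC subrK.
  by apply: filD; [exact: fil1 | exact: fil_sub fX].
have full : forall x, filtration (X g1) (X g2) (X g3) 0 x.
  by apply: filtration_full; apply: f_unit;
    [exact: fil_gen1 | exact: fil_gen2 | exact: fil_gen3].
rewrite geltM.
have := @primitive_functional K p A (X g1) (X g2) (X g3) (@aug K gT) (pairing xi)
  (Xp g1) (Xp g2) (Xp g3) (augmentation_aug K gT) full.
move=> ->; rewrite ?aug_gelt ?mulr1 ?mul1r //.
- exact: (pairingDr xi).
- exact: (pairingZr xi).
- have := xiP 0%N 0%N 0%N (ltnW p_gt1) (ltnW p_gt1) (ltnW p_gt1).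
  rewrite !expr0 !mulr1 => ->.
  by rewrite -!natrM; case: a b c abc {xiP} => [|[|a]] [|[|b]] [|[|c]].
- move=> i j k ip jp kp ijk; have := xiP i j k ip jp kp => ->.
  rewrite -!natrM (_ : (a == i) * (b == j) * (c == k) = 0)%N //.
  by apply/eqP; rewrite !muln_eq0 !eqb0; lia.
Qed.
End ElementaryAbelian.

(** * The dual of the order *)

Theorem proposition5p7 (p : nat) (K : fieldType) (v : K -> \bar int) (pi : K)
    (gT : finGroupType) (g1 g2 g3 : gT)
    (xi100 xi010 xi001 : gdual K gT)
    (i1 i2 i3 : nat) (mu alpha beta : K) :
  p \in [pchar K]%R ->
  discrete_valuation v -> valuation_complete v -> v pi = 1%:E ->
  (p.-abelem [set: gT])%g -> #|[set: gT]%G| = (p ^ 3)%N ->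
  (<<[set g1; g2; g3]>> = [set: gT])%g ->
  is_xi p g1 g2 g3 1 0 0 xi100 ->
  is_xi p g1 g2 g3 0 1 0 xi010 ->
  is_xi p g1 g2 g3 0 0 1 xi001 ->
  ((i2%:Z - (p * i1)%N%:Z)%:E <= v (wp p mu))%E ->
  ((i3%:Z - (p * i1)%N%:Z)%:E <= v (wp p alpha + wp p mu * beta)%R)%E ->
  ((i3%:Z - (p * i2)%N%:Z)%:E <= v (wp p beta))%E ->
  ((i3%:Z - i1%:Z)%:E <= v mu)%E ->
  (i3 <= i2)%N ->
  dual_order (valuation_ring v)
    (Hstar v pi xi100 xi010 xi001 i1 i2 i3 mu alpha beta)
  = Eorder p v pi g1 g2 g3 i1 i2 i3 mu alpha beta.
Proof.
move=> charK valv _ vpi abelemG _ genG xi1P xi2P xi3P vmu valpha vbeta _ _.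
have abG : abelian [set: gT] by case/and3P: abelemG.
pose A := comm_galg K abG.
have ringR := valuation_subring valv.
set R := valuation_ring v in ringR *.
have pi_neq0 n : pi ^+ n != 0 by rewrite expf_neq0 // (uniformizer_neq0 valv vpi).
have Rpi n : R (pi ^+ n) := valuation_ringX valv vpi n.
have Rscale a b x : ((a%:Z - (p * b)%N%:Z)%:E <= v x)%E ->
    R ((pi ^+ b) ^+ p * (pi ^+ a)^-1 * x).
  by move=> /(valuation_ring_scale valv vpi); rewrite -exprM mulnC.
have {vmu} Rmu := Rscale _ _ _ vmu.
have {valpha} Ralpha := Rscale _ _ _ valpha.
have {vbeta Rscale} Rbeta := Rscale _ _ _ vbeta.
have augE : @is_augmentation K A (@aug K gT) := augmentation_aug K gT.
have gp g : (gelt K g : A) ^+ p = 1 by exact: gelt_exp_prime.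
pose x1 : A := gelt K g1.
pose x2 : A := gelt K g2 * trunc_exp p x1 mu.
pose x3 : A := gelt K g3 * trunc_exp p x1 alpha * trunc_exp p x2 beta.
pose y1 : A := (pi ^+ i1)^-1 *: (x1 - 1).
pose y2 : A := (pi ^+ i2)^-1 *: (x2 - 1).
pose y3 : A := (pi ^+ i3)^-1 *: (x3 - 1).
pose E := @subalgebra_gen K R A [set y1; y2; y3]%classic.
(* E is formed in the commutative copy of the group algebra; both have the same
   operations, so it is convertible to the order of the statement. *)
change (dual_order R (Hstar v pi xi100 xi010 xi001 i1 i2 i3 mu alpha beta) = E).
have full : forall x, filtration y1 y2 y3 0 x.
  have [f1 f2 f3] := fil_twisted charK (gelt K g3 : A) mu alpha beta (gp g1) (gp g2)
    (pi_neq0 i1) (pi_neq0 i2) (pi_neq0 i3).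
  exact: (filtration_full genG f1 f2 f3).
have [xi1a xi1b xi1c] := xi_gen charK xi1P erefl.
have [xi2a xi2b xi2c] := xi_gen charK xi2P erefl.
have [xi3a xi3b xi3c] := xi_gen charK xi3P erefl.
have xiE := (xi1a, xi1b, xi1c, xi2a, xi2b, xi2c, xi3a, xi3b, xi3c).
have xi1M := xi_additive abG charK abelemG genG xi1P erefl.
have xi2M := xi_additive abG charK abelemG genG xi2P erefl.
have xi3M := xi_additive abG charK abelemG genG xi3P erefl.
(* An integral combination e of the basis dual to y1, y2, y3 acts on E as a
   derivation with values e on the generators modulo degree 1; the three
   generators of H* are the cases e = (1,0,0), (0,1,0), (0,0,1). *)
have key (f : gdual K gT) (e1 e2 e3 : nat) : additive_on f ->
    pairing f (gelt K g1) = pi ^+ i1 * e1%:R ->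
    pairing f (gelt K g2) + mu * pairing f (gelt K g1) = pi ^+ i2 * e2%:R ->
    pairing f (gelt K g3) + alpha * pairing f (gelt K g1)
      + beta * (pairing f (gelt K g2) + mu * pairing f (gelt K g1))
      = pi ^+ i3 * e3%:R ->
    [/\ @is_derivation K A (gdual_act f), forall x, E x -> E (gdual_act f x)
      & [/\ aug (gdual_act f y1) = e1%:R, aug (gdual_act f y2) = e2%:R
          & aug (gdual_act f y3) = e3%:R]].
  move=> fM h1 h2 h3; have derf := gdual_act_derivation abG fM.
  have Dg g : (gdual_act f (gelt K g) : A) = pairing f (gelt K g) *: (gelt K g : A).
    exact: gdual_act_gelt.
  have [Ey1 Ey2 Ey3] := der_twisted_order charK ringR (gp g1) (gp g2)
    (pi_neq0 i1) (pi_neq0 i2) (pi_neq0 i3) derf (Dg g1) (Dg g2) (Dg g3) h1 h2 h3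
    (Rpi i1) (Rpi i2) (Rpi i3) Rmu Ralpha Rbeta
    (subring_nat ringR e1) (subring_nat ringR e2) (subring_nat ringR e3).
  have aug_y := aug_der_twisted charK (gp g1) (gp g2) (gp g3)
    (pi_neq0 i1) (pi_neq0 i2) (pi_neq0 i3) derf (Dg g1) (Dg g2) (Dg g3)
    h1 h2 h3 augE.
  split=> //; apply: der_subalgebra_gen => // x [[|]|] ->.
  - exact: Ey1.
  - exact: Ey2.
  - exact: Ey3.
pose fA := pi ^+ i1 *: (xi100 - mu *: xi010 - alpha *: xi001).
pose fB := pi ^+ i2 *: (xi010 - beta *: xi001).
pose fC := pi ^+ i3 *: xi001.
have fAM : additive_on fA.
  apply/additive_onZ/additive_onB; last exact: additive_onZ.
  by apply: additive_onB => //; apply: additive_onZ.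
have fBM : additive_on fB.
  by apply/additive_onZ/additive_onB => //; apply: additive_onZ.
have fCM : additive_on fC by apply: additive_onZ.
have [|||derA EA [A1 A2 A3]] := key fA 1%N 0%N 0%N fAM;
  try by rewrite !(pairingBl, pairingZl) !xiE; ring.
have [|||derB EB [B1 B2 B3]] := key fB 0%N 1%N 0%N fBM;
  try by rewrite !(pairingBl, pairingZl) !xiE; ring.
have [|||derC EC [C1 C2 C3]] := key fC 0%N 0%N 1%N fCM;
  try by rewrite !pairingZl !xiE; ring.
have algE : @is_subalgebra K R A E := subalgebra_genP R _.
have y1p : y1 ^+ p = 0 by apply/(scaled_nilpotent charK)/gp.
have y2p : y2 ^+ p = 0.
  by apply/(scaled_nilpotent charK)/(twisted_order2 charK mu (gp g1) (gp g2)).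
have y3p : y3 ^+ p = 0.
  apply/(scaled_nilpotent charK).
  exact: (twisted_order3 charK mu alpha beta (gp g1) (gp g2) (gp g3)).
have augR x : E x -> R (aug x).
  apply: (aug_subalgebra_gen augE ringR) => y.
  by case=> [[->|->]|->]; rewrite (aug_nilp augE (p := p)) //; apply: subring0.
apply/seteqP; split=> x.
- move=> Hx; apply: (mem_subalgebra_gen_dop charK ringR y1p y2p y3p augE full
    derA derB derC A1 A2 A3 B1 B2 B3 C1 C2 C3).
    move=> i j k e Ee; apply: augR.
    elim: i => [|i IHi]; last exact: EA.
    elim: j => [|j IHj]; last exact: EB.
    by elim: k => [|k IHk] //; exact: EC.
  move=> i j k.
  rewrite /dop -!gdual_actX -!gdual_actM -pairing_gdual_act; apply: Hx.
  have algH := @subalgebra_genP K R (gdual K gT) [set fA; fB; fC]%classic.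
  do 2?apply: (subalgM algH); apply: (subalgX algH); apply: mem_subalgebra_gen.
  + by left; left.
  + by left; right.
  + by right.
- move=> Ex h Hh.
  rewrite pairing_gdual_act; apply: augR; move: x Ex.
  pose B := [set h : gdual K gT | forall x, E x -> E (gdual_act h x)]%classic.
  apply: (subalgebra_gen_sub (B := B)) Hh => /=.
    split=> /= [x Ex|f1 f2 E1 E2 x Ex|f1 f2 E1 E2 x Ex|c f1 Rc E1 x Ex].
    + by rewrite gdual_act1.
    + by rewrite gdual_actB; apply: (subalgB algE); [exact: E1 | exact: E2].
    + by rewrite gdual_actM; apply: E1; apply: E2.
    + by rewrite gdual_actZ; apply: (subalgZ algE) => //; apply: E1.
  by move=> f [[|]|] ->; [exact: EA | exact: EB | exact: EC].
Qed.
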